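(* There exist absolute constants $c_0,c_1,c_2>0$ for which the following holds. Let $F=\{f_1,\ldots,f_M\}$ and assume that there exists $\theta_0>0$ for which $$\|f\|_{L_4}\le\theta_0\|f\|_{L_2}\qquad\text{for every } f\in\operatorname{span}(F),$$ and let $N\ge(c_0\theta_0^4)^2M$. Set $\zeta=Y-f^*(X)$, assume $\mathbb{E}\zeta^4<\infty$, and put $\sigma=(\mathbb{E}\zeta^4)^{1/4}$. Then, for every $x>0$, with probability at least $1-\exp(-N/(c_1\theta_0^8))-(1/x)$, $$\|\hat f-f^*\|_{L_2}^2=R(\hat f)-\min_{f\in\operatorname{span}(F)}R(f)\le c_2\theta_0^{12}\cdot\frac{\sigma^2Mx}{N},$$ where $\hat f\in\operatorname{arg\,min}_{f\in\operatorname{span}(F)}R_N(f)$ is the empirical risk minimizer.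
   Context: $(\mathcal{X},\mu)$ is a probability space, $X$ is a random variable with values in $\mathcal{X}$ distributed according to $\mu$, and $Y$ is a real-valued random variable (the target) with $\mathbb{E}Y^2<\infty$. $(X_i,Y_i)_{i=1}^N$ are $N$ independent copies of $(X,Y)$; ''with probability'' refers to this sample. $F=\{f_1,\ldots,f_M\}$ is a finite set (dictionary) of real-valued measurable functions on $\mathcal{X}$ with $\mathbb{E}f_j(X)^2<\infty$, and $\operatorname{span}(F)=\{\sum_{j=1}^M t_jf_j : t\in\mathbb{R}^M\}$. $\|f\|_{L_p}=(\mathbb{E}|f(X)|^p)^{1/p}$. The risk of a (deterministic) $f$ is $R(f)=\mathbb{E}(Y-f(X))^2$; for a sample-dependent $\hat f$, $R(\hat f)=\mathbb{E}\bigl((Y-\hat f(X))^2\mid (X_i,Y_i)_{i=1}^N\bigr)$ with $(X,Y)$ independent of the sample, and likewise $\|\hat f-f^*\|_{L_2}^2=\mathbb{E}\bigl((\hat f(X)-f^*(X))^2\mid (X_i,Y_i)_{i=1}^N\bigr)$. The oracle $f^*\in\operatorname{span}(F)$ is a function with $R(f^* )=\inf_{f\in\operatorname{span}(F)}R(f)$. The empirical risk is $R_N(f)=\frac1N\sum_{i=1}^N(Y_i-f(X_i))^2$. Absolute constants do not depend on any of the other quantities (the distribution of $(X,Y)$, $F$, $M$, $N$, $\theta_0$, $x$). *)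

(* Defs.v *)
From HB Require Import structures.
From mathcomp Require Import all_boot all_order all_algebra.
From mathcomp Require Import all_classical all_reals all_analysis measurable_realfun.
Set Implicit Arguments.
Unset Strict Implicit.
Unset Printing Implicit Defensive.
Import Order.TTheory GRing.Theory Num.Theory.
Import numFieldNormedType.Exports.

Local Open Scope classical_set_scope.
Local Open Scope ring_scope.

Section independence.
Context d {T : measurableType d} {R : realType} (P : probability T R).

Definition independent2 d1 d2 (U : measurableType d1) (V : measurableType d2)
    (Z1 : T -> U) (Z2 : T -> V) : Prop :=
  forall (A : set U) (B : set V), measurable A -> measurable B ->
    (P (Z1 @^-1` A `&` Z2 @^-1` B) = P (Z1 @^-1` A) * P (Z2 @^-1` B))%E.

Definition mutually_independent (I : finType) d1 (U : measurableType d1)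
    (Z : I -> T -> U) : Prop :=
  forall (J : {set I}) (A : I -> set U), (forall i, measurable (A i)) ->
    P (\bigcap_(i in [set` J]) Z i @^-1` A i) =
    (\prod_(i in J) P (Z i @^-1` A i))%E.

Definition same_law d1 (U : measurableType d1) (Z1 Z2 : T -> U) : Prop :=
  forall A : set U, measurable A -> P (Z1 @^-1` A) = P (Z2 @^-1` A).

(* [W] is a version of E(Z | S) for a nonnegative random variable [Z]. The
   sigma-algebra generated by [S] is exactly the set of preimages under [S] of
   measurable sets. *)
Definition cond_expectation d1 (U : measurableType d1) (S : T -> U)
    (Z : T -> R) (W : T -> \bar R) : Prop :=
  [/\ forall B : set (\bar R), measurable B ->
        preimage_set_system setT S measurable (W @^-1` B),
      forall w, (0 <= W w)%E
    & forall A, preimage_set_system setT S measurable A ->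
        (\int[P]_(w in A) W w = \int[P]_(w in A) (Z w)%:E)%E].

End independence.

Definition lin_span {X : Type} {R : realType} {M : nat} (f : 'I_M -> X -> R) :
    set (X -> R) :=
  [set g | exists t : 'I_M -> R, g = fun x => \sum_(j < M) t j * f j x].

Definition Lp_norm d d' {T : measurableType d} {X : measurableType d'}
    {R : realType} (P : probability T R) (x : T -> X) (p : R) (f : X -> R) :
    \bar R :=
  'N[P]_(p%:E)[EFin \o (f \o x)]%E.

Definition risk d {T : measurableType d} {X : Type} {R : realType}
    (P : probability T R) (x : T -> X) (y : T -> R) (f : X -> R) : \bar R :=
  'E_P[(fun w => (y w - f (x w)) ^+ 2)%R]%E.

Definition min_risk d {T : measurableType d} {X : Type} {R : realType}
    (P : probability T R) (x : T -> X) (y : T -> R) (C : set (X -> R)) :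
    \bar R :=
  ereal_inf [set risk P x y f | f in C].

Definition empirical_risk {X : Type} {R : realType} {N : nat}
    (z : N.-tuple (X * R)) (f : X -> R) : R :=
  N%:R^-1 * \sum_(i < N) ((tnth z i).2 - f (tnth z i).1) ^+ 2.

Definition empirical_minimizers {X : Type} {R : realType} {N : nat}
    (C : set (X -> R)) (z : N.-tuple (X * R)) : set (X -> R) :=
  [set f | C f /\ forall g, C g -> empirical_risk z f <= empirical_risk z g].

(* Main.v *)
Require Import Defs.
From HB Require Import structures.
From mathcomp Require Import all_boot all_order all_algebra.
From mathcomp Require Import all_classical all_reals all_analysis measurable_realfun.
From mathcomp Require Import ring lra.
Import Order.TTheory GRing.Theory Num.Theory.
Import numFieldNormedType.Exports.
Local Open Scope classical_set_scope.
Local Open Scope ring_scope.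

Set Implicit Arguments.
Unset Strict Implicit.
Unset Printing Implicit Defensive.

(** The excess risk of the empirical minimizer is controlled by two facts about
    the vectors h = fhat - fstar of the span. Write P_N for the empirical mean
    and zeta for Y - fstar(X). Comparing the empirical risks of fhat and fstar
    gives P_N h^2 <= 2 P_N (zeta h), and minimality of fstar makes zeta
    orthogonal to the span, so the excess risk is exactly the squared L2 norm
    of h. It therefore suffices to bound P_N h^2 from below by a multiple of
    the squared norm, uniformly over the span, and P_N (zeta h) from above;
    [erm_deterministic] combines the two bounds.

    Both bounds are written in an L2-orthonormal family e_1, ..., e_m of the
    span, m <= M, obtained by factoring the Gram matrix of the dictionary
    ([psd_factor]); the linear combinations it misses vanish almost surely at
    every sample point.

    The noise term. If h = sum_j a_j e_j then P_N (zeta h) = sum_j a_j s_j with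
    s_j = P_N (zeta e_j). The summands of s_j are independent and centered, so
    E s_j^2 = E (zeta e_j)^2 / N <= sigma^2 theta^2 / N by Cauchy-Schwarz, and
    Markov's inequality applied to sum_j s_j^2 costs the probability 1/x
    ([noise_event]).

    The lower bound ([uniform_lower_bound]). For one fixed v in the span, lower
    deviations of P_N min(v^2, B) have exponentially small probability, with B
    of order theta^4, because E v^4 <= theta^4 (E v^2)^2 and Chernoff's bound
    only needs two moments of v^2 ([truncated_lower_tail]). A union bound over
    the points of a lattice of mesh 1/(2 sqrt m) in a ball costs exp(O(m)),
    which the sample size absorbs. The passage from the lattice to an arbitrary
    unit vector h is by rounding: among the lattice neighbours of h there is a v
    for which P_N min(v^2, B) - |v|^2 exceeds P_N h^2 - |h|^2 by no more than
    the mean over the sample of min((e_1^2 + ... + e_m^2) / (16 m), B)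
    ([truncated_round]). That error is an average of bounded variables of
    expectation at most 1/16, hence small except on an exponentially rare event
    ([truncated_upper_tail]); it is for its sake that v^2 is truncated, since
    without truncation the sum of the e_j^2 has only polynomial tails.

    Finally the two conditional expectations of the statement are identified
    almost surely with functions of the sample: by independence of (X, Y) and
    the sample one may integrate over (X, Y) with the sample frozen
    ([cond_expectation_independent]), and versions of a conditional expectation
    agree almost surely ([cond_expectation_unique]). *)

(** * Orthonormalization of a positive semidefinite form *)

Definition psd (R : rcfType) n (G : 'M[R]_n) :=
  G^T = G /\ forall u : 'rV[R]_n, 0 <= (u *m G *m u^T) 0 0.

(** Polarization: a symmetric form is determined by its quadratic form. *)
Lemma psd_isotropic (R : rcfType) n (G : 'M[R]_n) :
  G^T = G -> (forall u : 'rV[R]_n, (u *m G *m u^T) 0 0 = 0) -> G = 0.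
Proof.
move=> sG G0; apply/matrixP => i j; rewrite [RHS]mxE.
pose b (u v : 'rV[R]_n) := (u *m G *m v^T) 0 0.
have bD u v : b (u + v) (u + v) = b u u + b v v + b u v + b v u.
  by rewrite /b linearD/= !mulmxDl !mulmxDr ![fun_of_matrix (_ + _) _ _]mxE; ring.
have bs u v : b u v = b v u.
  rewrite /b -[in LHS](trmxK (u *m G *m v^T)) mxE.
  by rewrite !trmx_mul trmxK sG mulmxA.
have : b (delta_mx 0 i) (delta_mx 0 j) = 0.
  have := bD (delta_mx 0 i) (delta_mx 0 j).
  by rewrite {1 2 3}/b !G0 (bs (delta_mx 0 j)); lra.
by rewrite /b -rowE trmx_delta -colE !mxE.
Qed.

(** For a Gram matrix G, the rows of A are the coefficients of an orthonormal
    family, and the second identity says that G-projecting onto that family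
    loses nothing but vectors of norm zero. This is Gram-Schmidt in a form that
    tolerates a singular G: split off a unit vector u and deflate G to
    G - G u^T u G, which has smaller rank. *)
Lemma psd_factor (R : rcfType) n k (G : 'M[R]_n) : psd G ->
  (\rank G <= k)%N ->
  exists (m : nat) (A : 'M[R]_(m, n)),
    [/\ (m <= k)%N, A *m G *m A^T = 1%:M & G *m A^T *m A *m G = G].
Proof.
elim: k G => [|k IH] G [sG pG] rG.
  exists 0%N, 0; split => //; first by apply/matrixP => -[].
  by move: rG; rewrite leqn0 mxrank_eq0 => /eqP ->; rewrite !mulmx0.
have [->|G0] := eqVneq G 0.
  exists 0%N, 0; split => //; first by apply/matrixP => -[].
  by rewrite !mulmx0.
(* u is any non-isotropic vector, normalized. *)
have [u uGu] : exists u : 'rV[R]_n, u *m G *m u^T = 1%:M.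
  have [u u0] : exists u : 'rV[R]_n, (u *m G *m u^T) 0 0 != 0.
    apply/not_existsP => h; case/negP: G0; apply/eqP; apply: psd_isotropic => // u.
    by have /negP := h u; rewrite negbK => /eqP.
  set q := (u *m G *m u^T) 0 0 in u0.
  have q0 : 0 < q by rewrite lt_neqAle eq_sym u0 pG.
  exists ((Num.sqrt q)^-1 *: u).
  rewrite linearZ/= -!scalemxAl -scalemxAr scalerA.
  rewrite [_ *m _ *m _]mx11_scalar -/q -invfM -expr2 sqr_sqrtr ?ltW//.
  by rewrite scale_scalar_mx mulVf.
(* D projects onto the G-orthogonal complement of u. *)
pose D := 1%:M - G *m u^T *m u; pose G' := D *m G.
have G'E : G' = G - G *m u^T *m (u *m G).
  by rewrite /G' /D mulmxBl mul1mx !mulmxA.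
have DT : D^T = 1%:M - u^T *m u *m G.
  by rewrite /D linearB/= trmx1 !trmx_mul trmxK sG mulmxA.
have G'E2 : G' = G *m D^T by rewrite DT mulmxBr mulmx1 G'E !mulmxA.
have DuG : D *m (G *m u^T) = 0.
  by rewrite mulmxBl mul1mx -!mulmxA [u *m _]mulmxA uGu mulmx1 subrr.
have G'u : G' *m u^T = 0 by rewrite -mulmxA.
have sG' : G'^T = G' by rewrite {1}/G' trmx_mul sG -G'E2.
have DGD : D *m G *m D^T = G'.
  have -> : D *m G = G' by [].
  by rewrite DT mulmxBr mulmx1 -[_ *m u *m G]mulmxA [G' *m _]mulmxA G'u mul0mx subr0.
have DG : D *m G = G' by [].
clearbody G'; clearbody D.
(* u^T is in the kernel of G' but not in that of G. *)
have rG' : (\rank G' <= k)%N.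
  rewrite -DG -ltnS (leq_trans _ rG)// ltn_neqAle mxrankM_maxr andbT.
  apply/negP => /eqP rr.
  have /submxP[E GE] : (G <= G')%MS.
    by have := mxrank_leqif_sup (submxMl D G); rewrite rr DG => -[_ <-]; rewrite eqxx.
  have : u *m G *m u^T = 0 by rewrite GE -!mulmxA G'u !mulmx0.
  by rewrite uGu => /matrixP/(_ 0 0)/eqP; rewrite !mxE/= oner_eq0.
have [|m [A [mk AGA GAAG]]] := IH G' _ rG'.
  split => // v; have := pG (v *m D).
  by rewrite -DGD trmx_mul !mulmxA.
have uGD : u *m G *m D^T = 0.
  by rewrite -mulmxA -G'E2 -[LHS]trmxK trmx_mul sG' G'u trmx0.
exists (1 + m)%N, (col_mx u (A *m D)); split => //.
  rewrite mul_col_mx tr_col_mx mul_col_row uGu trmx_mul !mulmxA uGD mul0mx.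
  have -> : A *m D *m G *m u^T = 0 by rewrite -!mulmxA DuG mulmx0.
  have -> : A *m D *m G *m D^T = A *m G' by rewrite -DGD !mulmxA.
  by rewrite AGA -scalar_mx_block.
rewrite -mulmxA mul_col_mx tr_col_mx mul_mx_row mul_row_col.
rewrite -[A *m D *m G]mulmxA DG trmx_mul [G *m (D^T *m _)]mulmxA -G'E2.
by rewrite [G' *m _ *m _]mulmxA GAAG G'E addrC subrK.
Qed.

(** * Lattice rounding of a vector, and the size of the lattice net *)

Section rounding.
Variables (R : realType) (I : finType) (m : nat).
Implicit Types (w : I -> R) (y : I -> 'I_m -> R) (v : 'I_m -> R).

(** With w_i = 1/N on a set of sample points and y_ij = e_j(X_i), the amount by
    which the empirical square of sum_j v_j e_j exceeds its squared norm. *)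
Definition gap w y v : R :=
  \sum_i w i * (\sum_j v j * y i j) ^+ 2 - \sum_j v j ^+ 2.

Lemma gap_shift w y v (l : 'I_m) (s : R) :
  gap w y (fun j => v j + s *+ (j == l)) =
  gap w y v + 2 * s * (\sum_i w i * (\sum_j v j * y i j) * y i l - v l)
    + s ^+ 2 * (\sum_i w i * y i l ^+ 2 - 1).
Proof.
rewrite /gap.
have sq : \sum_j (v j + s *+ (j == l)) ^+ 2 =
    \sum_j v j ^+ 2 + 2 * s * v l + s ^+ 2.
  rewrite (bigD1 l)//= eqxx [in RHS](bigD1 l)//= mulr1n.
  rewrite (eq_bigr (fun j => v j ^+ 2)); first by ring.
  by move=> j /negPf ->; rewrite mulr0n addr0.
have lin i : \sum_j (v j + s *+ (j == l)) * y i j = \sum_j v j * y i j + s * y i l.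
  rewrite (bigD1 l)//= eqxx [in RHS](bigD1 l)//= mulr1n.
  rewrite (eq_bigr (fun j => v j * y i j)); first by ring.
  by move=> j /negPf ->; rewrite mulr0n addr0.
rewrite sq (eq_bigr (fun i => w i * (\sum_j v j * y i j) ^+ 2 +
  2 * s * (w i * (\sum_j v j * y i j) * y i l) + s ^+ 2 * (w i * y i l ^+ 2))).
  by rewrite !big_split/= -!mulr_sumr; ring.
by move=> i _; rewrite lin; ring.
Qed.

(** Along one coordinate [gap] is a quadratic polynomial of leading coefficient
    p - 1. If a is rounded at random to one of its two neighbours in the lattice
    of mesh e, without bias, the linear term averages to zero and the square of
    the displacement to at most e^2/4; one of the two choices does at least as
    well as the average. *)
Lemma round_coordinate (a e p q : R) : 0 < e -> 0 <= p ->
  exists k : int, `|e * k%:~R - a| <= e /\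
    2 * (e * k%:~R - a) * q + (e * k%:~R - a) ^+ 2 * (p - 1) <= e ^+ 2 / 4 * p.
Proof.
move=> e0 p0.
set k := Num.floor (a / e); set r := a - e * k%:~R.
have r0 : 0 <= r.
  by rewrite subr_ge0 -ler_pdivlMl// mulrC floor_le_tmp.
have re : r < e.
  have := floorD1_gt (a / e); rewrite -/k ltr_pdivrMr// intrD/= /r.
  by lra.
have E1 : e * k%:~R - a = - r by rewrite /r; ring.
have E2 : e * (k + 1)%:~R - a = e - r by rewrite intrD/= /r; ring.
have [h|h] := leP (2 * (- r) * q + (- r) ^+ 2 * (p - 1)) (e ^+ 2 / 4 * p).
  by exists k; rewrite E1 normrN ger0_norm// (ltW re).
exists (k + 1); rewrite E2 ger0_norm; last by lra.
split; first by lra.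
rewrite leNgt; apply/negP => h2.
have rer : 0 <= r * (e - r) by rewrite mulr_ge0//; lra.
have rer4 : r * (e - r) <= e ^+ 2 / 4 by have := sqr_ge0 (r - e / 2); lra.
have h1' : e ^+ 2 / 4 * p * (e - r) < (2 * (- r) * q + (- r) ^+ 2 * (p - 1)) * (e - r).
  by rewrite ltr_pM2r//; lra.
have h2' : e ^+ 2 / 4 * p * r <= (2 * (e - r) * q + (e - r) ^+ 2 * (p - 1)) * r.
  by rewrite ler_wpM2r// ltW.
(* The two failures, averaged with the weights of the unbiased rounding. *)
have := ltr_leD h1' h2'.
suff : 0 <= e * ((e ^+ 2 / 4 - r * (e - r)) * p + r * (e - r)) by lra.
by rewrite mulr_ge0 ?(ltW e0)// addr_ge0// mulr_ge0//; lra.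
Qed.

(** Rounding the coordinates one after the other accumulates the errors of
    [round_coordinate]. *)
Lemma round_vector w y (h : 'I_m -> R) (e : R) : (forall i, 0 <= w i) -> 0 < e ->
  exists k : 'I_m -> int, (forall j, `|e * (k j)%:~R - h j| <= e) /\
    gap w y (fun j => e * (k j)%:~R) <=
    gap w y h + e ^+ 2 / 4 * \sum_j \sum_i w i * y i j ^+ 2.
Proof.
move=> w0 e0.
suff H (n : nat) : exists k : 'I_m -> int, (forall j, `|e * (k j)%:~R - h j| <= e) /\
    gap w y (fun j => if (j < n)%N then e * (k j)%:~R else h j) <=
    gap w y h + e ^+ 2 / 4 * \sum_(j < m | (j < n)%N) \sum_i w i * y i j ^+ 2.
  have [k [kh kg]] := H m; exists k; split => //.
  move: kg; rewrite (_ : (fun j => if _ then _ else _) = fun j => e * (k j)%:~R).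
    by rewrite (eq_bigl xpredT)// => j; rewrite ltn_ord.
  by apply/funext => j; rewrite ltn_ord.
elim: n => [|n [k [kh kg]]].
  have k1 j : exists k : int, `|e * k%:~R - h j| <= e.
    by have [k []] := @round_coordinate (h j) e 0 0 e0 (lexx _); exists k.
  exists (fun j => sval (cid (k1 j))); split=> [j|]; first by case: cid.
  by rewrite big_pred0// mulr0 addr0.
have [nm|mn] := ltnP n m; last first.
  exists k; split => //.
  suff E (j : 'I_m) : (j < n.+1)%N = (j < n)%N.
    rewrite (eq_bigl (fun j : 'I_m => (j < n)%N))//.
    by under [X in gap w y X]eq_fun do rewrite E.
  by rewrite !(leq_trans (ltn_ord j))// (leq_trans mn).
pose l := Ordinal nm.
pose v (j : 'I_m) := if (j < n)%N then e * (k j)%:~R else h j.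
have vl : v l = h l by rewrite /v ltnn.
pose q := \sum_i w i * (\sum_j v j * y i j) * y i l - v l.
pose p := \sum_i w i * y i l ^+ 2.
have p0 : 0 <= p by apply: sumr_ge0 => i _; rewrite mulr_ge0// sqr_ge0.
have [z [zh zq]] := round_coordinate (h l) q e0 p0.
exists (fun j => if j == l then z else k j); split.
  by move=> j; case: eqP => // ->.
pose s := e * z%:~R - h l.
rewrite (_ : (fun j : 'I_m => _) = fun j => v j + s *+ (j == l)); last first.
  apply/funext => j; rewrite /v; case: eqP => [->|/eqP jl].
    by rewrite ltnS leqnn ltnn mulr1n /s addrC subrK.
  by rewrite mulr0n addr0 ltnS leq_eqVlt -[(j == n :> nat)]/(j == l) (negPf jl).
rewrite gap_shift -/q -/p.
rewrite [X in _ <= _ + _ * X](_ : _ = p + \sum_(j < m | (j < n)%N) \sum_i w i * y i j ^+ 2).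
  move: (kg : gap w y v <= _) zq; rewrite -/s mulrDr.
  set S := \sum_(j < m | _) _; set g := gap w y v.
  by lra.
rewrite (bigD1 l)//=; congr (_ + _); apply: eq_bigl => j.
by rewrite ltnS ltn_neqAle andbC -[(j == n :> nat)]/(j == l).
Qed.

End rounding.

(** Truncation at B is concave, so it is compatible with rounding: on the sample
    points where the rounding error g fits below B the truncated square is
    bounded by the square and [round_vector] applies, and elsewhere it is
    bounded by B, which is then the value of the error term. *)
Lemma truncated_round (R : realType) (N m : nat) (y : 'I_N -> 'I_m -> R)
    (h : 'I_m -> R) (e B : R) : 0 < e ->
  exists k : 'I_m -> int, (forall j, `|e * (k j)%:~R - h j| <= e) /\
    N%:R^-1 * (\sum_i Num.min ((\sum_j e * (k j)%:~R * y i j) ^+ 2) B)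
      - \sum_j (e * (k j)%:~R) ^+ 2 <=
    N%:R^-1 * (\sum_i (\sum_j h j * y i j) ^+ 2) - \sum_j h j ^+ 2
    + N%:R^-1 * (\sum_i Num.min (e ^+ 2 / 4 * \sum_j y i j ^+ 2) B).
Proof.
move=> e0.
pose g i := e ^+ 2 / 4 * \sum_j y i j ^+ 2.
pose I i := (g i <= B).
have N0 : 0 <= N%:R^-1 :> R by rewrite invr_ge0.
have w0 i : 0 <= N%:R^-1 *+ I i :> R by rewrite mulrn_wge0.
have [k [kh]] := round_vector y h w0 e0; rewrite /gap => kg.
exists k; split => //.
pose c := \sum_i (if I i then 0 else B).
have le1 : N%:R^-1 * (\sum_i Num.min ((\sum_j e * (k j)%:~R * y i j) ^+ 2) B) <=
    \sum_i N%:R^-1 *+ I i * (\sum_j e * (k j)%:~R * y i j) ^+ 2 + N%:R^-1 * c.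
  rewrite /c !mulr_sumr -big_split/= ler_sum// => i _.
  case: (I i) => /=; first by rewrite mulr1n mulr0 addr0 ler_wpM2l// ge_min lexx.
  by rewrite mulr0n mul0r add0r ler_wpM2l// ge_min lexx orbT.
have le2 : \sum_i N%:R^-1 *+ I i * (\sum_j h j * y i j) ^+ 2 <=
    N%:R^-1 * (\sum_i (\sum_j h j * y i j) ^+ 2).
  rewrite mulr_sumr ler_sum// => i _; rewrite ler_wpM2r ?sqr_ge0//.
  by case: (I i); rewrite ?mulr1n ?mulr0n.
have -> : N%:R^-1 * (\sum_i Num.min (g i) B) =
    e ^+ 2 / 4 * (\sum_j \sum_i N%:R^-1 *+ I i * y i j ^+ 2) + N%:R^-1 * c.
  rewrite exchange_big/= /c !mulr_sumr -big_split/=; apply: eq_bigr => i _.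
  rewrite -mulr_sumr /g; have [gB|Bg] := leP; rewrite /I /g ?gB ?[_ <= B]leNgt ?Bg/=.
    by rewrite mulr1n; ring.
  by rewrite mulr0n mul0r mulr0 add0r.
by lra.
Qed.

Section net.
Variables (R : realType) (m K : nat).

(** Sign and absolute value are kept separately, so that the geometric weight
    used in [card_net] depends on one component only; zero is represented
    twice. *)
Definition net_point (k : {ffun 'I_m -> bool * 'I_K.+1}) (j : 'I_m) : R :=
  (-1) ^+ (k j).1 * (k j).2%:R.

Lemma sum_geometric_half (n : nat) : \sum_(i < n) 2^-1 ^+ i <= 2 :> R.
Proof.
suff -> : \sum_(i < n) 2^-1 ^+ i = 2 - 2 * 2^-1 ^+ n :> R.
  by rewrite gerBl mulr_ge0// exprn_ge0.
elim: n => [|n IH]; first by rewrite big_ord0 expr0; lra.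
by rewrite big_ord_recr/= IH exprS; lra.
Qed.

(** Give each point k the weight prod_j 2^(-|k_j|). The total weight is at most
    4^m because it factors over the coordinates, and each point of the ball has
    weight at least 2^(-L) since |n| <= n^2 for integers. *)
Lemma card_net (L : nat) :
  (#|[set k | (\sum_j net_point k j ^+ 2 <= L%:R)%R]%SET|%:R <= 2 ^+ L * 4 ^+ m :> R).
Proof.
rewrite -ler_pdivrMl ?exprn_gt0// mulrC -exprVn -sumr_const big_distrl/=.
under eq_bigr do rewrite mul1r.
pose g (a : bool * 'I_K.+1) : R := 2^-1 ^+ a.2.
apply: (@le_trans _ _ (\sum_(k : {ffun 'I_m -> bool * 'I_K.+1}) \prod_j g (k j))).
  rewrite big_mkcond ler_sum// => k _; case: ifPn => [|_]; last first.
    by rewrite prodr_ge0// => j _; rewrite exprn_ge0.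
  rewrite inE => kL; rewrite /g -expr_sum ler_wiXn2l//; try lra.
  rewrite -(ler_nat R) (le_trans _ kL)// natr_sum ler_sum// => j _.
  rewrite /net_point exprMn sqrr_sign mul1r -natrX ler_nat.
  by case: (nat_of_ord (k j).2) => // n; rewrite -mulnn leq_pmull.
rewrite -(bigA_distr_bigA (fun=> g))/=.
rewrite prodr_const card_ord lerXn2r ?nnegrE// ?sumr_ge0//.
  by move=> *; rewrite exprn_ge0.
rewrite -(pair_big xpredT xpredT (fun (_ : bool) (i : 'I_K.+1) => 2^-1 ^+ i))/=.
by rewrite big_bool/=; have := sum_geometric_half K.+1; lra.
Qed.

Lemma net_point_onto (k : 'I_m -> int) : (forall j, (`|k j| <= K)%N) ->
  exists k' : {ffun 'I_m -> bool * 'I_K.+1}, forall j, net_point k' j = (k j)%:~R.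
Proof.
move=> kK; exists [ffun j => (k j < 0, inord `|k j|%N)] => j.
rewrite /net_point ffunE/= inordK ?ltnS//.
by rewrite [in RHS](intEsign (k j)) intrM rmorph_sign.
Qed.

End net.

(** * Expectations of real random variables *)

Section measurable_bigops.
Context d (T : measurableType d) (R : realType).

Lemma measurable_bigsum I (r : seq I) (Q : pred I) (F : I -> T -> R) :
  (forall i, measurable_fun setT (F i)) ->
  measurable_fun setT (fun w => \sum_(i <- r | Q i) F i w).
Proof.
move=> mF; elim: r => [|a r IH]; first by under eq_fun do rewrite big_nil; exact: measurable_cst.
under eq_fun do rewrite big_cons.
by case: (Q a) => //; exact: measurable_funD.
Qed.

Lemma measurable_bigprod I (r : seq I) (Q : pred I) (F : I -> T -> R) :
  (forall i, measurable_fun setT (F i)) ->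
  measurable_fun setT (fun w => \prod_(i <- r | Q i) F i w).
Proof.
move=> mF; elim: r => [|a r IH]; first by under eq_fun do rewrite big_nil; exact: measurable_cst.
under eq_fun do rewrite big_cons.
by case: (Q a) => //; exact: measurable_funM.
Qed.

End measurable_bigops.

Section integrals.
Context d (T : measurableType d) (R : realType) (P : probability T R).

(** Real-valued integrands, so that expectations can be computed in R. *)
Definition rv_integrable (h : T -> R) := P.-integrable setT (EFin \o h).

Lemma rv_integrableE (h : T -> R) : rv_integrable h ->
  (\int[P]_w (h w)%:E = (\int[P]_w h w)%R%:E)%E.
Proof. by move=> ih; rewrite /Rintegral fineK// integrable_fin_num. Qed.

Lemma rv_integrable_cst (c : R) : rv_integrable (cst c).
Proof. exact: finite_measure_integrable_cst. Qed.

Lemma rv_integrableD (f g : T -> R) :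
  rv_integrable f -> rv_integrable g -> rv_integrable (fun w => f w + g w).
Proof. by move=> fi gi; apply: (integrableD measurableT fi gi). Qed.

Lemma rv_integrableZ (c : R) (f : T -> R) :
  rv_integrable f -> rv_integrable (fun w => c * f w).
Proof. by move=> fi; apply: (integrableZl measurableT c fi). Qed.

Lemma rv_integrableB (f g : T -> R) :
  rv_integrable f -> rv_integrable g -> rv_integrable (fun w => f w - g w).
Proof. by move=> fi gi; apply: (integrableB measurableT fi gi). Qed.

Lemma rv_integrable_sum I (r : seq I) (F : I -> T -> R) :
  (forall i, rv_integrable (F i)) -> rv_integrable (fun w => \sum_(i <- r) F i w).
Proof.
move=> Fi; elim: r => [|a r IH].
  by under eq_fun do rewrite big_nil; exact: rv_integrable_cst.
by under eq_fun do rewrite big_cons; exact: rv_integrableD.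
Qed.

Lemma rv_integrable_measurable (f : T -> R) : rv_integrable f -> measurable_fun setT f.
Proof. by move=> /measurable_int /measurable_EFinP. Qed.

Lemma rv_integrable_dom (f g : T -> R) : measurable_fun setT f ->
  (forall w, `|f w| <= g w) -> rv_integrable g -> rv_integrable f.
Proof.
move=> mf fg gi; apply: (le_integrable measurableT _ _ gi); first exact/measurable_EFinP.
by move=> w _; rewrite /= lee_fin (le_trans (fg w))// ler_norm.
Qed.

Lemma rv_expectation_cst (c : R) : \int[P]_w c = c.
Proof. by rewrite /Rintegral integral_cst//= probability_setT mule1. Qed.

Lemma rv_expectationD (f g : T -> R) : rv_integrable f -> rv_integrable g ->
  \int[P]_w (f w + g w) = \int[P]_w f w + \int[P]_w g w.
Proof. exact: RintegralD. Qed.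

Lemma rv_expectationB (f g : T -> R) : rv_integrable f -> rv_integrable g ->
  \int[P]_w (f w - g w) = \int[P]_w f w - \int[P]_w g w.
Proof. exact: RintegralB. Qed.

Lemma rv_expectationZ c (f : T -> R) : rv_integrable f ->
  \int[P]_w (c * f w) = c * \int[P]_w f w.
Proof. exact: RintegralZl. Qed.

Lemma rv_expectation_sum I (r : seq I) (F : I -> T -> R) :
  (forall i, rv_integrable (F i)) ->
  \int[P]_w (\sum_(i <- r) F i w) = \sum_(i <- r) \int[P]_w F i w.
Proof.
move=> Fi; elim: r => [|a r IH].
  by under eq_Rintegral do rewrite big_nil; rewrite big_nil rv_expectation_cst.
under eq_Rintegral do rewrite big_cons.
by rewrite rv_expectationD ?big_cons ?IH//; exact: rv_integrable_sum.
Qed.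

Lemma le_rv_expectation (f g : T -> R) : rv_integrable f -> rv_integrable g ->
  (forall w, f w <= g w) -> \int[P]_w f w <= \int[P]_w g w.
Proof. by move=> fi gi fg; apply: le_Rintegral. Qed.

Lemma ge0_integral_le_fin (f g : T -> R) : measurable_fun setT f ->
  (forall w, 0 <= f w) -> (forall w, f w <= g w) -> rv_integrable g ->
  (\int[P]_w (f w)%:E <= (\int[P]_w g w)%:E)%E.
Proof.
move=> mf f0 fg gi; rewrite -rv_integrableE//; apply: ge0_le_integral => //.
- by move=> w _; rewrite lee_fin.
- exact/measurable_EFinP.
- by apply/measurable_EFinP; exact: rv_integrable_measurable.
- by move=> w _; rewrite lee_fin.
Qed.

Lemma rv_markov (f : T -> R) (c : R) : measurable_fun setT f ->
  (forall w, 0 <= f w) -> 0 < c ->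
  (c%:E * P [set w | (c <= f w)%R] <= \int[P]_w (f w)%:E)%E.
Proof.
move=> mf f0 c0.
have mA : measurable [set w | c <= f w].
  by rewrite -[X in measurable X]setTI; apply: measurable_fun_le => //; exact: measurable_cst.
rewrite -[X in (_ * P X)%E]setIT -integral_indic// -ge0_integralZl_EFin//; last 2 first.
- by apply/measurable_EFinP.
- exact: ltW.
apply: ge0_le_integral => //.
- by move=> w _; rewrite -EFinM lee_fin mulr_ge0// ltW.
- by apply/measurable_EFinP; apply: measurable_funM.
- by apply/measurable_EFinP.
move=> w _; rewrite -EFinM lee_fin indicE.
by have [/set_mem/= h|_] := boolP (w \in _); rewrite ?mulr1 ?mulr0.
Qed.

End integrals.

Lemma powR_root (R : realType) (a : R) (n : nat) : (0 < n)%N -> 0 <= a ->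
  (a `^ n%:R^-1) ^+ n = a.
Proof.
move=> n0 a0; rewrite -powR_mulrn ?powR_ge0// -powRrM mulVf ?powRr1//.
by rewrite pnatr_eq0 -lt0n.
Qed.

Section moments.
Context d (T : measurableType d) (R : realType) (P : probability T R).

Lemma ge0_integrable (h : T -> R) : measurable_fun setT h -> (forall w, 0 <= h w) ->
  (\int[P]_w (h w)%:E < +oo)%E -> rv_integrable P h.
Proof.
move=> mh h0 hoo; apply/integrableP; split; first exact/measurable_EFinP.
by under eq_integral do rewrite gee0_abs ?lee_fin//.
Qed.

Lemma Lnorm_natE (n : nat) (h : T -> R) :
  'N[P]_(n%:R%:E)[EFin \o h]%E = poweR (\int[P]_w (`|h w| ^+ n)%:E)%E n%:R^-1.
Proof.
rewrite unlock; congr poweR; apply: eq_integral => w _ /=.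
by rewrite powR_mulrn.
Qed.

(** The norm hypothesis with the roots removed. *)
Lemma fourth_moment_of_Lnorm (theta : R) (h : T -> R) : measurable_fun setT h ->
  0 < theta -> rv_integrable P (fun w => h w ^+ 2) ->
  ('N[P]_(4%:E)[EFin \o h] <= theta%:E * 'N[P]_(2%:E)[EFin \o h])%E ->
  rv_integrable P (fun w => h w ^+ 4) /\
  \int[P]_w (h w ^+ 4) <= theta ^+ 4 * (\int[P]_w (h w ^+ 2)) ^+ 2.
Proof.
move=> mh theta0 ih2; rewrite !Lnorm_natE.
have E2 w : `|h w| ^+ 2 = h w ^+ 2 by rewrite real_normK ?num_real.
have E4 w : `|h w| ^+ 4 = h w ^+ 4 by rewrite -[4%N]/(2 * 2)%N !exprM E2.
under eq_integral do rewrite E4.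
under [X in (_ <= _ * poweR X _)%E]eq_integral do rewrite E2.
have h40 w : 0 <= h w ^+ 4 by rewrite -[4%N]/(2 * 2)%N exprM sqr_ge0.
have mh4 : measurable_fun setT (fun w => h w ^+ 4) by exact: measurable_funX.
rewrite [X in (_ <= _ * poweR X _)%E]rv_integrableE// => H.
have ih4 : rv_integrable P (fun w => h w ^+ 4).
  apply: ge0_integrable => //; rewrite ltey; apply/eqP => E.
  move: H; rewrite E /= invr_eq0 pnatr_eq0 /= -EFinM.
  by rewrite leye_eq.
split => //; move: H; rewrite [X in (poweR X _ <= _)%E]rv_integrableE//= lee_fin.
set r := \int[P]_w _; set q := \int[P]_w _ => H.
have r0 : 0 <= r by apply: Rintegral_ge0.
have q0 : 0 <= q by apply: Rintegral_ge0 => w _; exact: sqr_ge0.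
rewrite -[leLHS](@powR_root _ _ 4)//.
have -> : theta ^+ 4 * q ^+ 2 = (theta * q `^ 2^-1) ^+ 4.
  by rewrite exprMn -[4%N in RHS]/(2 * 2)%N !exprM (@powR_root _ _ 2).
by rewrite lerXn2r ?nnegrE ?mulr_ge0 ?powR_ge0// ltW.
Qed.

(** Jensen's inequality for the square, from the variance of h^2. *)
Lemma sqr_expectation_le (h : T -> R) : rv_integrable P (fun w => h w ^+ 2) ->
  rv_integrable P (fun w => h w ^+ 4) -> \int[P]_w (h w ^+ 2) = 1 ->
  1 <= \int[P]_w (h w ^+ 4).
Proof.
move=> i2 i4 h1.
have : 0 <= \int[P]_w (h w ^+ 4 - (2 * h w ^+ 2 - 1)).
  apply: Rintegral_ge0 => w _; have := sqr_ge0 (h w ^+ 2 - 1).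
  by rewrite -[4%N]/(2 * 2)%N exprM; lra.
have i22 : rv_integrable P (fun w => 2 * h w ^+ 2) by exact: rv_integrableZ.
rewrite rv_expectationB//; last by apply: rv_integrableB => //; exact: rv_integrable_cst.
rewrite rv_expectationB//; last exact: rv_integrable_cst.
by rewrite rv_expectationZ// rv_expectation_cst h1; lra.
Qed.

Lemma rv_integrableM (f g : T -> R) : measurable_fun setT f -> measurable_fun setT g ->
  rv_integrable P (fun w => f w ^+ 2) -> rv_integrable P (fun w => g w ^+ 2) ->
  rv_integrable P (fun w => f w * g w).
Proof.
move=> mf mg f2 g2; apply: (@rv_integrable_dom _ _ _ _ _ (fun w => f w ^+ 2 + g w ^+ 2)).
- exact: measurable_funM.
- move=> w; rewrite normrM -[f w ^+ 2]real_normK ?num_real// -[g w ^+ 2]real_normK ?num_real//.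
  by have := sqr_ge0 (`|f w| - `|g w|); have := sqr_ge0 (`|f w| + `|g w|); lra.
- exact: rv_integrableD.
Qed.

(** Cauchy-Schwarz for z^2 and e^2, through 2 a b <= l a^2 + b^2 / l. The bound
    s may be zero, in which case l is sent to infinity. *)
Lemma cauchy_schwarz_fourth (z e : T -> R) (s t : R) :
  measurable_fun setT z -> measurable_fun setT e -> 0 <= s -> 0 < t ->
  rv_integrable P (fun w => z w ^+ 4) -> rv_integrable P (fun w => e w ^+ 4) ->
  \int[P]_w (z w ^+ 4) <= s ^+ 4 -> \int[P]_w (e w ^+ 4) <= t ^+ 4 ->
  rv_integrable P (fun w => (z w * e w) ^+ 2) /\
  \int[P]_w ((z w * e w) ^+ 2) <= s ^+ 2 * t ^+ 2.
Proof.
move=> mz me s0 t0 iz ie zs et.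
have e4 (a : R) : a ^+ 4 = (a ^+ 2) ^+ 2 by rewrite -exprM.
have ize : rv_integrable P (fun w => (z w * e w) ^+ 2).
  under eq_fun do rewrite exprMn.
  apply: rv_integrableM; try exact: measurable_funX.
  - by under eq_fun do rewrite -e4.
  - by under eq_fun do rewrite -e4.
split => //.
have step (l : R) : 0 < l -> \int[P]_w ((z w * e w) ^+ 2) <=
    l / 2 * s ^+ 4 + l^-1 / 2 * t ^+ 4.
  move=> l0.
  apply: (@le_trans _ _ (\int[P]_w (l / 2 * z w ^+ 4 + l^-1 / 2 * e w ^+ 4))).
    apply: le_rv_expectation => //; first by apply: rv_integrableD; exact: rv_integrableZ.
    move=> w; rewrite exprMn !e4; set a := z w ^+ 2; set b := e w ^+ 2.
    have : 0 <= l^-1 * (l * a - b) ^+ 2 by rewrite mulr_ge0 ?sqr_ge0// invr_ge0 ltW.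
    have -> : l^-1 * (l * a - b) ^+ 2 = l * a ^+ 2 - 2 * a * b + l^-1 * b ^+ 2.
      by field; rewrite gt_eqF.
    by lra.
  rewrite rv_expectationD; try exact: rv_integrableZ.
  rewrite !rv_expectationZ// lerD// ler_wpM2l// divr_ge0// ?invr_ge0 ltW//.
have [s00|sn0] := eqVneq s 0; last first.
  have sp : 0 < s by rewrite lt_def sn0.
  (* The weight that balances the two terms. *)
  apply: (le_trans (step (t ^+ 2 / s ^+ 2) _)); first by rewrite divr_gt0 ?exprn_gt0.
  rewrite le_eqVlt; apply/orP; left; apply/eqP; field.
  by rewrite !gt_eqF.
rewrite s00 expr0n/= mul0r; apply/ler_addgt0Pr => x x0; rewrite add0r.
apply: (le_trans (step (t ^+ 4 / x) _)); first by rewrite divr_gt0 ?exprn_gt0.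
rewrite s00 expr0n/= mulr0 add0r.
rewrite (_ : _ * _ = x / 2); first by lra.
by field; rewrite !gt_eqF.
Qed.

Lemma measurable_ltr (f : T -> R) (c : R) : measurable_fun setT f ->
  measurable [set w | c < f w].
Proof.
move=> mf; have -> : [set w | c < f w] = f @^-1` `]c, +oo[.
  by apply/seteqP; split => w /=; rewrite in_itv/= andbT.
by rewrite -[X in measurable X]setTI; exact: mf.
Qed.

(** The strict inequality in the event is what makes the bound meaningful when
    K = 0: f is then almost surely zero. *)
Lemma markov_strict (f : T -> R) (K x : R) : measurable_fun setT f ->
  (forall w, 0 <= f w) -> rv_integrable P f -> 0 < x ->
  \int[P]_w f w <= K ->
  (P [set w | (x * K < f w)%R] <= (x^-1)%:E)%E.
Proof.
move=> mf f0 fi x0 fK.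
have K0 : 0 <= K by apply: le_trans fK; exact: Rintegral_ge0.
have small (a : R) : 0 < a -> (P [set w | (a <= f w)%R] <= (a^-1 * K)%:E)%E.
  move=> a0; rewrite EFinM lee_pdivlMl//.
  by rewrite (le_trans (rv_markov _ mf f0 a0))// rv_integrableE// lee_fin.
have mA (a : R) : measurable [set w | a <= f w].
  by rewrite -[X in measurable X]setTI; apply: measurable_fun_le => //; exact: measurable_cst.
have mB : measurable [set w | x * K < f w] by exact: measurable_ltr.
have [Kz|Kn] := eqVneq K 0; last first.
  have Kp : 0 < K by rewrite lt_def Kn.
  rewrite (@le_trans _ _ (P [set w | (x * K <= f w)%R]))//.
    by rewrite le_measure ?inE// => w /=; exact: ltW.
  rewrite (le_trans (small _ _)) ?mulr_gt0//.
  by rewrite lee_fin invfM -mulrA mulVf// mulr1.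
rewrite (_ : P _ = 0%E) ?lee_fin ?invr_ge0 ?ltW//; apply/negligibleP => //.
apply: (@negligibleS _ _ _ P (\bigcup_n [set w | n.+1%:R^-1 <= f w])).
  move=> w /=; rewrite Kz mulr0 => /ltr_add_invr[k]; rewrite add0r => h.
  by exists k => //=; exact: ltW.
apply: negligible_bigcup => n; apply/negligibleP => //.
by apply/eqP; rewrite -measure_le0 (le_trans (small _ _))// Kz mulr0.
Qed.

Lemma null_of_expectation0 (f : T -> R) : measurable_fun setT f ->
  (forall w, 0 <= f w) -> rv_integrable P f -> \int[P]_w f w = 0 ->
  P [set w | 0 < f w] = 0%E.
Proof.
move=> mf f0 fi f00; apply/eqP; rewrite -measure_le0.
apply/lee_addgt0Pr => y y0; rewrite add0e -[y]invrK.
rewrite (le_trans _ (@markov_strict f 0 y^-1 _ _ _ _ _))//.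
- by rewrite mulr0.
- by rewrite invr_gt0.
- by rewrite f00.
Qed.

Lemma probability_ge_good (E B1 B2 N0 : set T) (b1 b2 : R) :
  measurable E -> measurable B1 -> measurable B2 -> P.-negligible N0 ->
  (P B1 <= b1%:E)%E -> (P B2 <= b2%:E)%E ->
  (forall w, ~ B1 w -> ~ B2 w -> ~ N0 w -> E w) ->
  ((1 - b1 - b2)%:E <= P E)%E.
Proof.
move=> mE mB1 mB2 [N1 [mN1 PN1 N01]] P1 P2 H.
have mC : measurable (~` E) by exact: measurableC.
have PC : (P (~` E) <= (b1 + b2)%:E)%E.
  rewrite (@le_trans _ _ (P ((B1 `|` B2) `|` N1)))//.
    rewrite le_measure ?inE//; first by do 2 apply: measurableU => //.
    move=> w Ew; apply: contrapT => /not_orP[/not_orP[h1 h2] h3]; apply: Ew.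
    by apply: H => // /N01.
  rewrite (le_trans (measureU2 _ _ _))//; first exact: measurableU.
  rewrite [X in (_ + X)%E]PN1 adde0 (le_trans (measureU2 _ _ _))//.
  by rewrite EFinD leeD.
have -> : P E = (1 - P (~` E))%E.
  by rewrite -{1}[E]setCK probability_setC.
rewrite -addrA -opprD EFinB leeB//.
Qed.

End moments.

(** * Independence: products, laws and conditional expectations *)

Section independent_products.
Context d d1 (T : measurableType d) (U : measurableType d1) (R : realType)
  (P : probability T R).
Import HBNNSimple.

(** The step from events to functions of one coordinate: H stands for the
    product of the factors that depend on the other coordinates, c for its
    expectation, and g is approximated by simple functions. *)
Lemma decouple_indicator (Z : T -> U) (H : T -> R) (c : R) (g : U -> R) :
  measurable_fun setT Z -> measurable_fun setT H -> (forall w, 0 <= H w) ->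
  0 <= c ->
  (forall A, measurable A ->
     (\int[P]_w (\1_A (Z w) * H w)%:E = \int[P]_w (\1_A (Z w))%:E * c%:E)%E) ->
  measurable_fun setT g -> (forall u, 0 <= g u) ->
  (\int[P]_w (g (Z w) * H w)%:E = \int[P]_w (g (Z w))%:E * c%:E)%E.
Proof.
move=> mZ mH H0 c0 IH mg g0.
have mg' : measurable_fun setT (EFin \o g) by exact/measurable_EFinP.
pose f := nnsfun_approx measurableT mg'.
have fg u : (f n u)%:E @[n --> \oo] --> (g u)%:E.
  by have := cvg_nnsfun_approx measurableT mg' (fun u _ => g0 u) (x := u) I.
have mfZ n : measurable_fun setT (f n \o Z) by exact: measurableT_comp.
have step n : (\int[P]_w (f n (Z w) * H w)%:E = c%:E * \int[P]_w (f n (Z w))%:E)%E.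
  have mI (r : R) : measurable_fun setT (fun w => \1_(f n @^-1` [set r]) (Z w) : R).
    exact: measurableT_comp.
  have rI0 r u : (0 <= (r * \1_(f n @^-1` [set r]) u)%:E)%E by exact: nnfun_muleindic_ge0.
  transitivity (\int[P]_w (\sum_(r \in range (f n))
      (r * \1_(f n @^-1` [set r]) (Z w) * H w)%:E))%E.
    apply: eq_integral => w _; rewrite EFinM fimfunE -fsumEFin//.
    by rewrite ge0_mule_fsuml// => r; exact: rI0.
  rewrite ge0_integral_fsum//; last 2 first.
  - move=> r; apply/measurable_EFinP; apply: measurable_funM => //.
    exact: measurable_funM.
  - by move=> r w _; rewrite EFinM mule_ge0 ?lee_fin// -lee_fin rI0.
  transitivity (c%:E * \int[P]_w (\sum_(r \in range (f n))
      (r * \1_(f n @^-1` [set r]) (Z w))%:E))%E; last first.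
    by congr (_ * _)%E; apply: eq_integral => w _; rewrite fimfunE -fsumEFin.
  rewrite [in RHS]ge0_integral_fsum//; last first.
    by move=> r; apply/measurable_EFinP; exact: measurable_funM.
  rewrite ge0_mule_fsumr; last first.
    by move=> r; apply: integral_ge0 => w _; exact: rI0.
  apply: eq_fsbigr => r _.
  have [r0|r0] := ltP r 0.
    have I0 w : \1_(f n @^-1` [set r]) (Z w) = 0 :> R.
      by rewrite preimage_nnfun0// indicE in_set0.
    by rewrite !integral0_eq ?mule0// => w _; rewrite I0 ?mulr0 ?mul0r.
  under eq_integral do rewrite -mulrA EFinM.
  rewrite ge0_integralZl_EFin//; last 2 first.
  - by move=> w _; rewrite lee_fin mulr_ge0.
  - by apply/measurable_EFinP; exact: measurable_funM.
  rewrite IH; last exact: measurable_funPTI.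
  under [in RHS]eq_integral do rewrite EFinM.
  rewrite ge0_integralZl_EFin//; last by exact/measurable_EFinP.
  by rewrite muleA muleC.
transitivity (limn (fun n => \int[P]_w (f n (Z w) * H w)%:E))%E.
  rewrite -monotone_convergence//.
  - apply: eq_integral => w _; apply/esym/cvg_lim => //.
    by under eq_fun do rewrite EFinM; rewrite EFinM; apply: cvgeZr.
  - by move=> n; apply/measurable_EFinP; apply: measurable_funM => //; exact: mfZ.
  - by move=> n w _; rewrite lee_fin mulr_ge0.
  - move=> w _ k l kl; rewrite lee_fin ler_wpM2r//.
    exact/lefP/nd_nnsfun_approx.
have cv : (\int[P]_w (f n (Z w))%:E)%E @[n --> \oo] --> (\int[P]_w (g (Z w))%:E)%E.
  have -> : (\int[P]_w (g (Z w))%:E = \int[P]_w limn (fun n => (f n (Z w))%:E))%E.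
    by apply: eq_integral => w _; apply/esym/cvg_lim.
  apply: cvg_monotone_convergence => //.
  - by move=> n; apply/measurable_EFinP; exact: mfZ.
  - by move=> n w _; rewrite lee_fin.
  - by move=> w _ k l kl; rewrite lee_fin; exact/lefP/nd_nnsfun_approx.
apply/cvg_lim => //; under eq_fun do rewrite step.
by rewrite muleC; apply: cvgeZl.
Qed.

(** Independence is the case where every g i is an indicator; the indicators are
    replaced by general functions one coordinate at a time. *)
Lemma expectation_prod_independent (N : nat) (Z : 'I_N -> T -> U)
    (g : 'I_N -> U -> R) :
  mutually_independent P Z -> (forall i, measurable_fun setT (Z i)) ->
  (forall i, measurable_fun setT (g i)) -> (forall i u, 0 <= g i u) ->
  (forall i, P.-integrable setT (fun w => (g i (Z i w))%:E)) ->
  (\int[P]_w (\prod_i g i (Z i w))%:E = (\prod_i \int[P]_w (g i (Z i w)))%R%:E)%E.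
Proof.
move=> indep mZ mg g0 ig.
(* Coordinates n and above still carry indicators. *)
suff H (n : nat) : (n <= N)%N -> forall g : 'I_N -> U -> R,
    (forall i, measurable_fun setT (g i)) -> (forall i u, 0 <= g i u) ->
    (forall i, P.-integrable setT (fun w => (g i (Z i w))%:E)) ->
    (forall i : 'I_N, (n <= i)%N -> exists2 A, measurable A & g i = \1_A) ->
  (\int[P]_w (\prod_i g i (Z i w))%:E = (\prod_i \int[P]_w (g i (Z i w)))%R%:E)%E.
  by apply: (H N) => // i; rewrite leqNgt ltn_ord.
elim: n => {mg g0 ig} [|n IH] nN {}g mg g0 ig gI.
  have {}gI i : {A | measurable A & g i = \1_A} by apply: cid2; exact: gI.
  pose A i := s2val (gI i).
  have mA i : measurable (A i) := s2valP (gI i).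
  have gA i : g i = \1_(A i) := s2valP' (gI i).
  have mZA i : measurable (Z i @^-1` A i) by rewrite -[X in measurable X]setTI; exact: mZ.
  have := indep [set: 'I_N]%SET A mA.
  set B := \bigcap_(i in _) _ => PB.
  have mB : measurable B by apply: fin_bigcap_measurable => // i _; exact: mZA.
  transitivity (\int[P]_w (\1_B w)%:E)%E.
    apply: eq_integral => w _; congr EFin; rewrite indicE.
    have [/set_mem wB|wB] := boolP (w \in B).
      rewrite big1// => i _; rewrite gA indicE mem_set//.
      by apply: (wB i); rewrite /= inE.
    have [i wi] : exists i, ~ A i (Z i w).
      apply/existsNP => h; case/negP: wB; apply/mem_set => i _; exact: h.
    by apply/eqP/prodf_eq0; exists i => //; rewrite gA indicE memNset.
  rewrite integral_indic// setIT [LHS]PB.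
  rewrite [LHS](eq_bigl xpredT); last by move=> i; rewrite /= finset.in_setT.
  rewrite -prodEFin; apply: eq_bigr => i _.
  rewrite gA /Rintegral.
  have -> : (\int[P]_w (\1_(A i) (Z i w))%:E = P (Z i @^-1` A i))%E.
    by rewrite (integral_indic P measurableT (mZA i)) setIT.
  by rewrite fineK// fin_num_measure.
pose i0 := Ordinal nN.
pose H w := \prod_(i | i != i0) g i (Z i w).
pose c := (\prod_(i | i != i0) \int[P]_w (g i (Z i w)))%R.
have fint h : P.-integrable setT (fun w => (h w)%:E) ->
    (\int[P]_w (h w)%:E = (\int[P]_w h w)%R%:E)%E.
  by move=> ih; rewrite /Rintegral fineK// integrable_fin_num.
rewrite [in RHS](bigD1 i0)//= EFinM -fint//.
under eq_integral do rewrite (bigD1 i0)//=.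
apply: (@decouple_indicator (Z i0) H c) => //.
- by apply: measurable_bigprod => i; exact: measurableT_comp.
- by move=> w; apply: prodr_ge0.
- by apply: prodr_ge0 => i _; apply: Rintegral_ge0.
move=> A mA.
pose g' i := if i == i0 then \1_A else g i.
have mgA : measurable_fun setT (\1_A : U -> R) by [].
have iA : P.-integrable setT (fun w => (\1_A (Z i0 w) : R)%:E).
  apply: (@le_integrable _ _ _ P _ measurableT _ (cst 1%E)).
  - by apply/measurable_EFinP; exact: measurableT_comp.
  - by move=> w _; rewrite /= lee_fin normr1 ger0_norm// indicE; case: (_ \in _).
  - exact: finite_measure_integrable_cst.
have IHg : (\int[P]_w (\prod_i g' i (Z i w))%:E =
    (\prod_i \int[P]_w (g' i (Z i w)))%R%:E)%E.
  apply: IH; first exact: ltnW.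
  - by move=> i; rewrite /g'; case: ifP.
  - by move=> i u; rewrite /g'; case: ifP.
  - by move=> i; rewrite /g'; case: eqP => // ->.
  - move=> i ni; rewrite /g'; case: eqP => [_|/eqP ii0]; first by exists A.
    apply: gI; rewrite ltn_neqAle ni andbT; apply: contra ii0 => /eqP ii0.
    by apply/eqP/val_inj.
transitivity (\int[P]_w (\prod_i g' i (Z i w))%:E)%E.
  apply: eq_integral => w _; rewrite (bigD1 i0)//= /g' eqxx /H; congr (_ * _)%:E.
  by apply: eq_bigr => i /negPf ->.
rewrite IHg (bigD1 i0)//= {1}/g' eqxx EFinM -fint//; congr (_ * _%:E)%E.
by apply: eq_bigr => i /negPf ii0; rewrite /g' ii0.
Qed.
End independent_products.

Section laws.
Context d (T : measurableType d) (R : realType) (P : probability T R).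

Lemma same_law_integral d1 (U : measurableType d1) (Z1 Z2 : T -> U) (g : U -> \bar R) :
  measurable_fun setT Z1 -> measurable_fun setT Z2 -> same_law P Z1 Z2 ->
  measurable_fun setT g -> (forall u, 0 <= g u)%E ->
  (\int[P]_w g (Z1 w) = \int[P]_w g (Z2 w))%E.
Proof.
move=> m1 m2 law mg g0.
pose Z1' : {mfun T >-> U} := HB.pack Z1 (isMeasurableFun.Build _ _ _ _ _ m1).
pose Z2' : {mfun T >-> U} := HB.pack Z2 (isMeasurableFun.Build _ _ _ _ _ m2).
have := @ge0_integral_distribution _ _ _ _ _ P Z1' g mg g0.
have := @ge0_integral_distribution _ _ _ _ _ P Z2' g mg g0.
rewrite /comp/= => <- <-.
by apply: eq_measure_integral => A mA _; exact: law.
Qed.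

(** Markov's inequality for the exponential of the sum, whose expectation
    factors. *)
Lemma chernoff_iid d1 (U : measurableType d1) (N : nat) (Z : 'I_N -> T -> U)
    (Z0 : T -> U) (g : U -> R) (a t : R) :
  mutually_independent P Z -> (forall i, measurable_fun setT (Z i)) ->
  measurable_fun setT Z0 -> (forall i, same_law P (Z i) Z0) ->
  measurable_fun setT g ->
  (\int[P]_w (expR (g (Z0 w)))%:E <= (expR a)%:E)%E ->
  (P [set w | (N%:R * t <= \sum_i g (Z i w))%R] <= (expR (N%:R * (a - t))%R)%:E)%E.
Proof.
move=> indep mZ mZ0 law mg ga.
have meg : measurable_fun setT (fun u => expR (g u)) by exact: measurableT_comp.
have mgZ i : measurable_fun setT (fun w => expR (g (Z i w))).
  by apply: (measurableT_comp meg).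
have Eg i : (\int[P]_w (expR (g (Z i w)))%:E = \int[P]_w (expR (g (Z0 w)))%:E)%E.
  apply: (@same_law_integral _ _ _ _ (fun u => (expR (g u))%:E)) => //.
  exact/measurable_EFinP.
have ig i : P.-integrable setT (fun w => (expR (g (Z i w)))%:E).
  apply/integrableP; split; first exact/measurable_EFinP.
  under eq_integral do rewrite gee0_abs ?lee_fin ?expR_ge0//.
  by rewrite Eg (le_lt_trans ga)// ltry.
set S := fun w => \sum_i g (Z i w).
have mS : measurable_fun setT S.
  by apply: measurable_bigsum => i; exact: (measurableT_comp mg).
have mA : measurable [set w | N%:R * t <= S w].
  by rewrite -[X in measurable X]setTI; apply: measurable_fun_le => //; exact: measurable_cst.
rewrite -[X in (P X <= _)%E]setIT -integral_indic//.
apply: (@le_trans _ _ (\int[P]_w (expR (- (N%:R * t)) * expR (S w))%:E)%E).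
  apply: ge0_le_integral => //.
  - by apply/measurable_EFinP.
  - by apply/measurable_EFinP; apply: measurable_funM => //; exact: measurableT_comp.
  move=> w _; rewrite lee_fin -expRD indicE.
  have [/set_mem/= h|_] := boolP (w \in _); last exact: expR_ge0.
  by rewrite -[leLHS]expR0 ler_expR addrC subr_ge0.
under eq_integral do rewrite EFinM /S expR_sum.
rewrite ge0_integralZl_EFin ?expR_ge0//; last 2 first.
- by move=> w _; rewrite lee_fin prodr_ge0// => i _; exact: expR_ge0.
- by apply/measurable_EFinP; exact: measurable_bigprod.
rewrite (@expectation_prod_independent _ _ _ _ _ _ _ Z (fun=> fun u => expR (g u)))//.
rewrite -EFinM lee_fin mulrBr addrC expRD ler_wpM2l ?expR_ge0//.
rewrite mulrC expRM_natr -{5}(card_ord N) -prodr_const ler_prod// => i _.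
rewrite Rintegral_ge0/=; last by move=> w _; exact: expR_ge0.
rewrite -lee_fin /Rintegral fineK; last exact: integrable_fin_num.
by rewrite Eg.
Qed.

(** The joint law is the product of the laws, so this is Tonelli's theorem. *)
Lemma independent2_integral d1 d2 (U : measurableType d1) (V : measurableType d2)
    (Z1 : T -> U) (Z2 : T -> V) (F : U * V -> \bar R) :
  measurable_fun setT Z1 -> measurable_fun setT Z2 -> independent2 P Z2 Z1 ->
  measurable_fun setT F -> (forall z, 0 <= F z)%E ->
  (\int[P]_w F (Z1 w, Z2 w) = \int[P]_w \int[P]_w' F (Z1 w, Z2 w'))%E.
Proof.
move=> m1 m2 ind mF F0.
have m12 : measurable_fun setT (fun w => (Z1 w, Z2 w)).
  exact: measurable_fun_pair.
pose Z1' : {mfun T >-> U} := HB.pack Z1 (isMeasurableFun.Build _ _ _ _ _ m1).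
pose Z2' : {mfun T >-> V} := HB.pack Z2 (isMeasurableFun.Build _ _ _ _ _ m2).
pose Z' : {mfun T >-> (U * V)%type} :=
  HB.pack (fun w => (Z1 w, Z2 w)) (isMeasurableFun.Build _ _ _ _ _ m12).
have := @ge0_integral_distribution _ _ _ _ _ P Z' F mF F0; rewrite /comp/= => <-.
transitivity (\int[distribution P Z1' \x distribution P Z2']_z F z)%E.
  apply: eq_measure_integral => A mA _; apply/esym.
  apply: product_measure_unique => // {A mA} A B mA mB /=.
  by rewrite /distribution/pushforward muleC -ind//= setIC.
rewrite fubini_tonelli1// ge0_integral_distribution//; last 2 first.
- exact: measurable_fun_fubini_tonelli_F.
- by move=> x; apply: integral_ge0.
apply: eq_integral => w _; rewrite /fubini_F /=.
rewrite ge0_integral_distribution//.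
by apply: measurableT_comp => //; exact: measurable_pair1.
Qed.

End laws.

Section conditional_expectation.
Context d (T : measurableType d) (R : realType) (P : probability T R).
Context d1 (U : measurableType d1) (S : T -> U).
Hypothesis mS : measurable_fun setT S.

Lemma cond_expectation_measurable (Z : T -> R) (W : T -> \bar R) :
  cond_expectation P S Z W -> measurable_fun setT W.
Proof.
move=> [mW _ _] _ B mB; rewrite setTI.
have [C mC <-] := mW B mB; exact: mS.
Qed.

(** The set where W1 < W2 is the countable union, over rationals q < r, of the
    sets where W1 <= q and r <= W2. Each of them belongs to the sigma-algebra of
    S, and comparing the two integrals over it gives r P(C) <= q P(C). The
    argument does not subtract integrals, so infinite values do no harm. *)
Lemma cond_expectation_le_null (Z : T -> R) (W1 W2 : T -> \bar R) :
  cond_expectation P S Z W1 -> cond_expectation P S Z W2 ->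
  P.-negligible [set w | (W1 w < W2 w)%E].
Proof.
move=> h1 h2.
have mW1 := cond_expectation_measurable h1.
have mW2 := cond_expectation_measurable h2.
case: h1 h2 => [sW1 W10 I1] [sW2 W20 I2].
(* q n and r n run through all pairs of rationals; values of n that code no pair
   give the empty set, as both are then 0. *)
pose q (n : nat) : R := ratr (odflt (0%R, 0%R) (unpickle n : option (rat * rat))).1.
pose r (n : nat) : R := ratr (odflt (0%R, 0%R) (unpickle n : option (rat * rat))).2.
pose A n := if (0 <= q n) && (q n < r n) then [set w | (W1 w <= (q n)%:E)%E] `&` [set w | ((r n)%:E <= W2 w)%E]
  else set0.
apply: (@negligibleS _ _ _ P (\bigcup_n A n)).
  move=> w /= h.
  have [a [b [W1a ab bW2]]] : exists a b : rat,
      [/\ (W1 w <= (ratr a)%:E)%E, ratr a < ratr b :> R & ((ratr b)%:E <= W2 w)%E].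
    have [x [y [W1x xy yW2]]] : exists x y : R, [/\ (W1 w <= x%:E)%E, x < y & (y%:E <= W2 w)%E].
      move: h (W10 w); case: (W1 w) => [x| |]//; case: (W2 w) => [y| |]//.
        by rewrite lte_fin => xy _; exists x, y.
      by move=> _ _; exists x, (x + 1); rewrite ltrDl ltr01 leey.
    have [a] := rat_in_itvoo xy; rewrite in_itv/= => /andP[xa ay].
    have [b] := rat_in_itvoo ay; rewrite in_itv/= => /andP[ab yb].
    exists a, b; split => //; first by rewrite (le_trans W1x)// lee_fin ltW.
    by rewrite (le_trans _ yW2)// lee_fin ltW.
  exists (pickle (a, b)) => //.
  rewrite /A /q /r pickleK/= ab andbT.
  by rewrite -lee_fin (le_trans (W10 w) W1a).
apply: negligible_bigcup => n; rewrite /A.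
case: ifPn => [/andP[q0 qr]|_]; last exact: negligible_set0.
have [B1 mB1 EB1] := sW1 _ (emeasurable_itv `]-oo, (q n)%:E]).
have [B2 mB2 EB2] := sW2 _ (emeasurable_itv `[(r n)%:E, +oo[).
set C := _ `&` _.
have EC : C = S @^-1` (B1 `&` B2).
  move: EB1 EB2; rewrite !setTI preimage_setI => -> ->.
  by apply/seteqP; split => w /=; rewrite !in_itv/= ?andbT.
have SC : preimage_set_system setT S measurable C.
  by exists (B1 `&` B2); [exact: measurableI|rewrite setTI].
have mC : measurable C by rewrite EC -[X in measurable X]setTI; apply: mS => //; exact: measurableI.
exists C; split => //.
have : ((r n)%:E * P C <= (q n)%:E * P C)%E.
  rewrite -!integral_cst//; apply: (@le_trans _ _ (\int[P]_(w in C) W2 w)%E).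
    apply: ge0_le_integral => //.
    - by move=> w _; rewrite lee_fin (le_trans q0)// ltW.
    - exact: measurable_funTS.
    - by move=> w [].
  rewrite I2// -I1//; apply: ge0_le_integral => //.
  - exact: measurable_funTS.
  - by move=> w [].
move=> h; apply/eqP; apply: contraPT h => PC0; apply/negP.
by rewrite lee_pmul2r ?fin_num_measure// ?lt0e ?PC0 ?measure_ge0// lee_fin -ltNge.
Qed.

Lemma cond_expectation_unique (Z : T -> R) (W1 W2 : T -> \bar R) :
  cond_expectation P S Z W1 -> cond_expectation P S Z W2 ->
  P.-negligible [set w | W1 w != W2 w].
Proof.
move=> h1 h2.
apply: negligibleS (negligibleU (cond_expectation_le_null h1 h2)
  (cond_expectation_le_null h2 h1)) => w /=.
by rewrite neq_lt => /orP[]; [left|right].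
Qed.

(** Integrate over X with S frozen. *)
Lemma cond_expectation_independent d2 (V : measurableType d2) (X : T -> V)
    (G : U * V -> R) :
  measurable_fun setT X -> independent2 P X S ->
  measurable_fun setT G -> (forall z, 0 <= G z) ->
  cond_expectation P S (fun w => G (S w, X w))
    (fun w => \int[P]_w' (G (S w, X w'))%:E)%E.
Proof.
move=> mX ind mG G0.
pose X' : {mfun T >-> V} := HB.pack X (isMeasurableFun.Build _ _ _ _ _ mX).
have mEG : measurable_fun setT (EFin \o G) by exact/measurable_EFinP.
pose Phi u := (\int[P]_w' (G (u, X w'))%:E)%E.
have mPhi : measurable_fun setT Phi.
  have EG0 z : (0 <= (EFin \o G) z)%E by rewrite lee_fin.
  have -> : Phi = fubini_F (distribution P X') (EFin \o G).
    apply/funext => u; rewrite /fubini_F.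
    rewrite (@ge0_integral_distribution _ _ _ _ _ P X' (fun v => (EFin \o G) (u, v)))//.
    by apply: measurableT_comp => //; exact: measurable_pair1.
  by apply: measurable_fun_fubini_tonelli_F.
split.
- move=> B mB; exists (Phi @^-1` B); first by rewrite -[X in measurable X]setTI; exact: mPhi.
  by rewrite setTI.
- by move=> w; apply: integral_ge0 => w' _; rewrite lee_fin.
move=> A [B mB]; rewrite setTI => <-{A}.
have mSB : measurable (S @^-1` B) by rewrite -[X in measurable X]setTI; exact: mS.
pose F (z : U * V) := ((\1_B z.1 * G z)%R)%:E.
have mF : measurable_fun setT F.
  apply/measurable_EFinP; apply: measurable_funM => //.
  by apply: (@measurableT_comp _ _ _ _ _ _ (\1_B : U -> R)).
have F0 z : (0 <= F z)%E by rewrite lee_fin mulr_ge0.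
have memB w : (w \in S @^-1` B) = (S w \in B) by apply/idP/idP; rewrite !inE.
transitivity (\int[P]_w F (S w, X w))%E; last first.
  rewrite [in RHS]integral_mkcond; apply: eq_integral => w _.
  rewrite /F patchE memB indicE /=.
  by case: ifPn => _; rewrite ?mul1r ?mul0r.
rewrite (independent2_integral mS mX ind mF F0) integral_mkcond.
apply: eq_integral => w _; rewrite patchE memB /F /=.
case: ifPn => h.
  by apply: eq_integral => w' _; rewrite indicE h mul1r.
by rewrite integral0_eq// => w' _; rewrite indicE (negPf h) mul0r.
Qed.
End conditional_expectation.

(** * Exponential tails of truncated sums *)

(** The truncation error x - min(x, 1) <= x^2 is absorbed by the quadratic
    term, which leaves a bound by moments of x itself. *)
Lemma expR_trunc_lower (R : realType) (x : R) : 0 <= x ->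
  expR (- Num.min x 1) <= 1 - x + 2 * x ^+ 2.
Proof.
move=> x0; have [x1|x1] := leP x 1; last first.
  apply: (@le_trans _ _ 1); first by rewrite -[leRHS]expR0 ler_expR; lra.
  have h : 0 <= (x - 1) * x by rewrite mulr_ge0//; lra.
  by lra.
have e1 := expR_ge1Dx x.
rewrite expRN (@le_trans _ _ (1 + x)^-1)//; first by rewrite lef_pV2 ?posrE//; lra.
rewrite -div1r ler_pdivrMr; last lra.
suff : 0 <= x ^+ 2 + 2 * (x * x ^+ 2) by lra.
by rewrite addr_ge0 ?sqr_ge0// !mulr_ge0// sqr_ge0.
Qed.

Lemma expR_trunc_upper (R : realType) (x : R) : 0 <= x ->
  expR (Num.min x 1 / 2) <= 1 + x.
Proof.
move=> x0.
have e1 (y : R) : 0 <= y -> y <= 1 -> expR (y / 2) <= 1 + y.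
  move=> y0 y1; have := expR_ge1Dx (- (y / 2)); rewrite expRN => h.
  rewrite -[leLHS]invrK (@le_trans _ _ (1 - y / 2)^-1)//.
    by rewrite lef_pV2 ?posrE ?invr_gt0 ?expR_gt0//; lra.
  rewrite -div1r ler_pdivrMr; last lra.
  suff : 0 <= y * (1 - y) by lra.
  by rewrite mulr_ge0//; lra.
have [x1|x1] := leP x 1; first exact: e1.
by rewrite (le_trans (e1 1 _ _))//; lra.
Qed.

Section truncated_tails.
Context d d1 (T : measurableType d) (U : measurableType d1) (R : realType)
  (P : probability T R) (N : nat) (Z : 'I_N -> T -> U) (Z0 : T -> U).
Hypothesis indep : mutually_independent P Z.
Hypothesis mZ : forall i, measurable_fun setT (Z i).
Hypothesis mZ0 : measurable_fun setT Z0.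
Hypothesis law : forall i, same_law P (Z i) Z0.

(** Chernoff's bound at parameter 1/B: by [expR_trunc_lower] the Laplace
    transform is at most exp(-E V / B + 2 k / B^2), and nonnegativity of V is
    what makes two moments suffice. *)
Lemma truncated_lower_tail (V : U -> R) (k B s : R) :
  measurable_fun setT V -> (forall u, 0 <= V u) -> 0 < B ->
  rv_integrable P (fun w => V (Z0 w)) -> rv_integrable P (fun w => V (Z0 w) ^+ 2) ->
  \int[P]_w (V (Z0 w) ^+ 2) <= k ->
  (P [set w | (\sum_i Num.min (V (Z i w)) B <=
       N%:R * (\int[P]_w V (Z0 w) - 2 * k / B - s))%R]
   <= (expR (- (N%:R * s / B)))%:E)%E.
Proof.
move=> mV V0 B0 iV iV2 Vk.
pose m := \int[P]_w V (Z0 w).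
pose g u := - Num.min (V u / B) 1.
have mg : measurable_fun setT g.
  apply: measurableT_comp => //; apply: measurable_minr => //.
  exact: measurable_funM.
pose t := - (m - 2 * k / B - s) / B.
have -> : [set w | \sum_i Num.min (V (Z i w)) B <= N%:R * (m - 2 * k / B - s)] =
    [set w | N%:R * t <= \sum_i g (Z i w)].
  apply/eq_set => w; rewrite /g sumrN /t mulNr mulrN lerN2 mulrA.
  rewrite ler_pdivlMr// mulr_suml.
  congr (is_true (_ <= _)); apply: eq_bigr => i _.
  by rewrite -[X in _ = Num.min _ X * _](@divff _ B) ?gt_eqF// -minr_pMl ?invr_ge0 ?ltW// mulfVK ?gt_eqF.
have -> : - (N%:R * s / B) = N%:R * (- (m / B) + 2 * (k / B ^+ 2) - t).
  by rewrite /t; field; rewrite gt_eqF.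
apply: (chernoff_iid _ indep mZ mZ0 law mg).
have pw w : expR (g (Z0 w)) <= 1 - B^-1 * V (Z0 w) + (2 / B ^+ 2) * V (Z0 w) ^+ 2.
  apply: (le_trans (expR_trunc_lower _)); first by rewrite divr_ge0// ltW.
  by rewrite le_eqVlt; apply/orP; left; apply/eqP; field; rewrite gt_eqF.
have i1 : rv_integrable P (fun w => 1 - B^-1 * V (Z0 w)).
  by apply: rv_integrableB; [exact: rv_integrable_cst|exact: rv_integrableZ].
have i2 : rv_integrable P (fun w => (2 / B ^+ 2) * V (Z0 w) ^+ 2).
  exact: rv_integrableZ.
apply: le_trans (ge0_integral_le_fin _ _ pw (rv_integrableD i1 i2)) _.
- by apply: measurableT_comp => //; exact: measurableT_comp.
- by move=> w; exact: expR_ge0.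
rewrite rv_expectationD// rv_expectationB ?rv_expectationZ//; last 2 first.
- exact: rv_integrable_cst.
- exact: rv_integrableZ.
rewrite rv_expectation_cst lee_fin (le_trans _ (expR_ge1Dx _))//.
rewrite -/m -addrA lerD2l mulrC lerD2l -!mulrA ler_pM2l// mulrC ler_wpM2r//.
by rewrite invr_ge0 exprn_ge0// ltW.
Qed.

(** Chernoff's bound at parameter 1/(2B), where the exponent stays in [0, 1/2]
    and the exponential is bounded by an affine function. *)
Lemma truncated_upper_tail (W : U -> R) (eta B u : R) :
  measurable_fun setT W -> (forall u, 0 <= W u) -> 0 < B ->
  rv_integrable P (fun w => W (Z0 w)) ->
  \int[P]_w (W (Z0 w)) <= eta ->
  (P [set w | (N%:R * u <= \sum_i Num.min (W (Z i w)) B)%R]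
   <= (expR (N%:R * (eta / B - u / (2 * B)))%R)%:E)%E.
Proof.
move=> mW W0 B0 iW Weta.
pose g v := Num.min (W v / B) 1 / 2.
have mg : measurable_fun setT g.
  apply: measurable_funM => //; apply: measurable_minr => //.
  exact: measurable_funM.
have -> : [set w | N%:R * u <= \sum_i Num.min (W (Z i w)) B] =
    [set w | N%:R * (u / (2 * B)) <= \sum_i g (Z i w)].
  apply/eq_set => w; rewrite -mulr_suml mulrA ler_pdivrMr ?mulr_gt0//.
  rewrite mulrA mulfVK// mulr_suml.
  congr (is_true (_ <= _)); apply: eq_bigr => i _.
  by rewrite -[X in _ = Num.min _ X * _](@divff _ B) ?gt_eqF// -minr_pMl ?invr_ge0 ?ltW// mulfVK ?gt_eqF.
apply: (chernoff_iid _ indep mZ mZ0 law mg).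
have pw w : expR (g (Z0 w)) <= 1 + B^-1 * W (Z0 w).
  apply: (le_trans (expR_trunc_upper _)); first by rewrite divr_ge0// ltW.
  by rewrite mulrC.
have i1 : rv_integrable P (fun w => B^-1 * W (Z0 w)) by exact: rv_integrableZ.
apply: le_trans (ge0_integral_le_fin _ _ pw (rv_integrableD (rv_integrable_cst _ _) i1)) _.
- by apply: measurableT_comp => //; exact: measurableT_comp.
- by move=> w; exact: expR_ge0.
rewrite rv_expectationD//; last exact: rv_integrable_cst.
rewrite rv_expectationZ// rv_expectation_cst lee_fin (le_trans _ (expR_ge1Dx _))//.
by rewrite lerD2l mulrC ler_pM2r// invr_gt0.
Qed.

End truncated_tails.

(** * A lower bound uniform over an orthonormal span *)

Lemma union_bound d (T : measurableType d) (R : realType) (P : probability T R)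
    (I : eqType) (r : seq I) (A : I -> set T) (b : R) :
  (forall i, measurable (A i)) ->
  {in r, forall i, (P (A i) <= b%:E)%E} ->
  (P (\big[setU/set0]_(i <- r) A i) <= ((size r)%:R * b)%:E)%E.
Proof.
move=> mA; elim: r => [|a r IH] Ab; first by rewrite big_nil measure0 mul0r.
rewrite big_cons (le_trans (measureU2 _ _ _))//; first exact: bigsetU_measurable.
rewrite /= -natr1 mulrDl mul1r addrC EFinD leeD// ?Ab ?mem_head// IH// => i ir.
by rewrite Ab// inE ir orbT.
Qed.

Section uniform_lower_bound.
Context d d1 (T : measurableType d) (U : measurableType d1) (R : realType)
  (P : probability T R) (N : nat) (Z : 'I_N -> T -> U) (Z0 : T -> U).
Hypothesis indep : mutually_independent P Z.
Hypothesis mZ : forall i, measurable_fun setT (Z i).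
Hypothesis mZ0 : measurable_fun setT Z0.
Hypothesis law : forall i, same_law P (Z i) Z0.
Variables (m : nat) (e : 'I_m -> U -> R) (theta : R).
Hypothesis N0 : (0 < N)%N.
Hypothesis m0 : (0 < m)%N.
Hypothesis theta0 : 0 < theta.
Hypothesis me : forall j, measurable_fun setT (e j).
Hypothesis ie : forall i j, rv_integrable P (fun w => e i (Z0 w) * e j (Z0 w)).
Hypothesis ee : forall i j, \int[P]_w (e i (Z0 w) * e j (Z0 w)) = (i == j)%:R.

Definition combination (a : 'I_m -> R) (u : U) : R := \sum_j a j * e j u.

Hypothesis ie4 : forall a, rv_integrable P (fun w => combination a (Z0 w) ^+ 4).
Hypothesis ee4 : forall a, \int[P]_w (combination a (Z0 w) ^+ 4) <=
  theta ^+ 4 * (\sum_j a j ^+ 2) ^+ 2.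

Lemma measurable_combination a : measurable_fun setT (combination a).
Proof.
by apply: measurable_bigsum => j; apply: measurable_funM.
Qed.

Lemma combination_sqrE a w : combination a (Z0 w) ^+ 2 =
  \sum_i \sum_j (a i * a j) * (e i (Z0 w) * e j (Z0 w)).
Proof.
rewrite /combination expr2 big_distrl/=; apply: eq_bigr => i _.
by rewrite big_distrr; apply: eq_bigr => j _ /=; ring.
Qed.

Lemma rv_integrable_combination_sqr a :
  rv_integrable P (fun w => combination a (Z0 w) ^+ 2).
Proof.
under eq_fun do rewrite combination_sqrE.
apply: rv_integrable_sum => i; apply: rv_integrable_sum => j.
exact: rv_integrableZ.
Qed.

Lemma expectation_combination_sqr a :
  \int[P]_w (combination a (Z0 w) ^+ 2) = \sum_j a j ^+ 2.
Proof.
under eq_Rintegral do rewrite combination_sqrE.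
rewrite rv_expectation_sum; last first.
  by move=> i; apply: rv_integrable_sum => j; exact: rv_integrableZ.
apply: eq_bigr => i _.
rewrite rv_expectation_sum; last by move=> j; exact: rv_integrableZ.
rewrite (bigD1 i)//= rv_expectationZ// ee eqxx mulr1 big1 ?addr0 ?expr2// => j ji.
by rewrite rv_expectationZ// ee eq_sym (negPf ji) mulr0.
Qed.

Variable B : R.
Hypothesis BE : B = 128 * theta ^+ 4.
(** With this mesh the ball of squared radius 5/2 contains every rounding of a
    unit vector, its lattice points k satisfy |k|^2 <= 10 m, and the expected
    rounding error (eps^2 / 4) E (e_1^2 + ... + e_m^2) is 1/16. *)
Let eps : R := (2 * Num.sqrt m%:R)^-1.
Let net := [set k : {ffun 'I_m -> bool * 'I_(10 * m).+1} |
  \sum_j @net_point R m (10 * m) k j ^+ 2 <= (10 * m)%:R]%SET.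
Let pt (k : {ffun 'I_m -> bool * 'I_(10 * m).+1}) (j : 'I_m) : R := eps * net_point R k j.
Let bad k := [set w | \sum_i Num.min (combination (pt k) (Z i w) ^+ 2) B <=
  N%:R * (\sum_j pt k j ^+ 2 - 1 / 4)].
Let heavy := [set w | N%:R * (1 / 4) <=
  \sum_i Num.min (eps ^+ 2 / 4 * \sum_j e j (Z i w) ^+ 2) B].

Let mR : 0 < m%:R :> R.
Proof. by rewrite ltr0n. Qed.

Let B0 : 0 < B.
Proof. by rewrite BE mulr_gt0// exprn_gt0. Qed.

Let eps0 : 0 < eps.
Proof. by rewrite invr_gt0 mulr_gt0// sqrtr_gt0. Qed.

Let eps2 : eps ^+ 2 = (4 * m%:R)^-1.
Proof. by rewrite /eps exprVn exprMn sqr_sqrtr ?ltW//; congr (_ * _)^-1; ring. Qed.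

Let mcomb_Z a i : measurable_fun setT (fun w => combination a (Z i w)).
Proof. by apply: (measurableT_comp (measurable_combination a)). Qed.

Let measurable_bad k : measurable (bad k).
Proof.
rewrite -[X in measurable X]setTI; apply: measurable_fun_le => //.
apply: measurable_bigsum => i; apply: measurable_minr => //.
exact: measurable_funX.
Qed.

Let mG : measurable_fun setT (fun u => eps ^+ 2 / 4 * \sum_j e j u ^+ 2).
Proof.
apply: measurable_funM => //; apply: measurable_bigsum => j.
exact: measurable_funX.
Qed.

Let measurable_heavy : measurable heavy.
Proof.
rewrite -[X in measurable X]setTI; apply: measurable_fun_le => //.
apply: measurable_bigsum => i; apply: measurable_minr => //.
exact: (measurableT_comp mG).
Qed.

(** The bound 8 theta^4 on the fourth moment comes from (5/2)^2 <= 8; for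
    B = 128 theta^4 the truncation costs 2 * 8 theta^4 / B = 1/8 and the
    deviation takes the other 1/8. *)
Let bad_prob k : k \in net -> (P (bad k) <= (expR (- (N%:R / (16 * B))))%:E)%E.
Proof.
rewrite inE => kL.
have pt2 : \sum_j pt k j ^+ 2 <= 5 / 2.
  under eq_bigr do rewrite exprMn.
  rewrite -mulr_sumr eps2 ler_pdivrMl ?mulr_gt0//.
  by rewrite (le_trans kL)// natrM; lra.
have pt20 : 0 <= \sum_j pt k j ^+ 2 by apply: sumr_ge0 => j _; exact: sqr_ge0.
have := @truncated_lower_tail _ _ _ _ _ P N Z Z0 indep mZ mZ0 law
  (fun u => combination (pt k) u ^+ 2) (8 * theta ^+ 4) B (1 / 8).
rewrite expectation_combination_sqr.
have -> : \sum_j pt k j ^+ 2 - 2 * (8 * theta ^+ 4) / B - 1 / 8 =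
    \sum_j pt k j ^+ 2 - 1 / 4.
  by rewrite BE; field; rewrite gt_eqF.
move=> H; apply: (le_trans (H _ _ _ _ _ _)) => {H} //.
- by apply: measurable_funX; exact: measurable_combination.
- by move=> u; exact: sqr_ge0.
- exact: rv_integrable_combination_sqr.
- by under eq_fun do rewrite -exprM; exact: ie4.
- under eq_Rintegral do rewrite -exprM.
  apply: (le_trans (ee4 _)); rewrite mulrC; apply: ler_wpM2r.
    by rewrite exprn_ge0// ltW.
  rewrite (@le_trans _ _ ((5 / 2) ^+ 2))//; last lra.
  by rewrite lerXn2r ?nnegrE.
rewrite lee_fin ler_expR lerN2.
rewrite [leRHS](_ : _ = 2 * (N%:R / (16 * B))); last first.
  by field; rewrite gt_eqF.
by rewrite ler_peMl ?ler1n// divr_ge0// mulr_ge0// ltW.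
Qed.

Let heavy_prob : (P heavy <= (expR (- (N%:R / (16 * B))))%:E)%E.
Proof.
have iG : rv_integrable P (fun w => \sum_j e j (Z0 w) ^+ 2).
  by apply: rv_integrable_sum => j; under eq_fun do rewrite expr2; exact: ie.
apply: le_trans (@truncated_upper_tail _ _ _ _ _ P N Z Z0 indep mZ mZ0 law
  (fun u => eps ^+ 2 / 4 * \sum_j e j u ^+ 2) (1 / 16) B (1 / 4) mG _ B0 _ _) _.
- move=> u; apply: mulr_ge0; first by rewrite divr_ge0// sqr_ge0.
  by apply: sumr_ge0 => j _; exact: sqr_ge0.
- exact: rv_integrableZ.
- rewrite rv_expectationZ// rv_expectation_sum; last first.
    by move=> j; under eq_fun do rewrite expr2; exact: ie.
  rewrite (eq_bigr (fun=> 1)); last first.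
    by move=> j _; under eq_Rintegral do rewrite expr2; rewrite ee eqxx.
  rewrite sumr_const card_ord eps2 le_eqVlt; apply/orP; left; apply/eqP.
  by field; rewrite gt_eqF.
rewrite lee_fin ler_expR le_eqVlt; apply/orP; left; apply/eqP.
by field; rewrite gt_eqF.
Qed.

(** The count is at most 2^(10 m) 4^m = 2^(12 m), the extra point stands for
    [heavy], and 2 <= exp 1. *)
Let net_size : #|net|%:R + 1 <= expR (13 * m%:R) :> R.
Proof.
have c := @card_net R m (10 * m) (10 * m).
have e2 : 2 <= expR 1 :> R by have := expR_ge1Dx (1 : R); lra.
apply: (@le_trans _ _ (2 ^+ (13 * m))).
  apply: (@le_trans _ _ (2 ^+ (12 * m) + 2 ^+ (12 * m))).
    rewrite lerD// ?exprn_ege1 ?ler1n//.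
    apply: (le_trans c); rewrite [X in _ * X ^+ _](_ : 4 = 2 ^+ 2); last by ring.
    by rewrite -exprM -exprD -mulnDl.
  have -> : 2 ^+ (12 * m) + 2 ^+ (12 * m) = 2 ^+ (12 * m).+1 :> R by rewrite exprS; ring.
  by rewrite ler_weXn2l ?ler1n// [(13 * m)%N]mulSn -[ltnLHS]add0n ltn_add2r.
rewrite -natrM -[X in expR X]mul1r expRM_natr.
by rewrite lerXn2r ?nnegrE ?expR_ge0.
Qed.

(** Off the bad events, rounding a unit vector h to v gives
    P_N h^2 >= 1 + (P_N min(v^2, B) - |v|^2) - 1/4 >= 1 - 1/4 - 1/4. *)
Lemma uniform_lower_bound : exists Bad : set T, [/\ measurable Bad,
  (P Bad <= (expR (13 * m%:R - N%:R / (16 * B)))%:E)%E &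
  forall w, ~ Bad w -> forall h : 'I_m -> R,
    1 / 2 * \sum_j h j ^+ 2 <= N%:R^-1 * \sum_i combination h (Z i w) ^+ 2].
Proof.
pose Bad := heavy `|` \big[setU/set0]_(k <- enum net) bad k.
exists Bad; split.
- by apply: measurableU => //; exact: bigsetU_measurable.
- rewrite (le_trans (measureU2 _ _ _))//; first exact: bigsetU_measurable.
  have ub := @union_bound _ _ _ P _ (enum net) bad
    (expR (- (N%:R / (16 * B)))) measurable_bad.
  apply: (le_trans (leeD heavy_prob (ub _))).
    by move=> k; rewrite mem_enum; exact: bad_prob.
  rewrite -EFinD lee_fin expRD -cardE addrC -[X in _ + X]mul1r -mulrDl.
  by rewrite ler_wpM2r ?expR_ge0 ?net_size.
move=> w wBad.
have NR : 0 < N%:R :> R by rewrite ltr0n.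
(* Both sides are homogeneous of degree two in h. *)
suff unit (h : 'I_m -> R) : \sum_j h j ^+ 2 = 1 ->
    1 / 2 <= N%:R^-1 * \sum_i combination h (Z i w) ^+ 2.
  move=> h; pose q := \sum_j h j ^+ 2; rewrite -/q.
  have q0 : 0 <= q by apply: sumr_ge0 => j _; exact: sqr_ge0.
  have [->|qn0] := eqVneq q 0.
    by rewrite mulr0 mulr_ge0 ?invr_ge0// sumr_ge0// => i _; exact: sqr_ge0.
  have := unit (fun j => (Num.sqrt q)^-1 * h j).
  have sq : (Num.sqrt q)^-1 ^+ 2 = q^-1 by rewrite exprVn sqr_sqrtr.
  under eq_bigr do rewrite exprMn sq.
  rewrite -mulr_sumr mulVf// => /(_ erefl).
  under eq_bigr => i _.
    rewrite /combination (eq_bigr (fun j => (Num.sqrt q)^-1 * (h j * e j (Z i w)))).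
      rewrite -mulr_sumr exprMn sq; over.
    by move=> j _; rewrite mulrA.
  have qgt0 : 0 < q by rewrite lt_def qn0.
  by rewrite -mulr_sumr mulrCA ler_pdivlMl// mulrC.
move=> h1.
have [k [kh kgap]] := truncated_round (fun i j => e j (Z i w)) h B eps0.
(* |v|^2 <= 2 |h|^2 + 2 m eps^2 = 2 + 1/2. *)
have kL : \sum_j (eps * (k j)%:~R) ^+ 2 <= 5 / 2.
  apply: (@le_trans _ _ (\sum_j (2 * h j ^+ 2 + 2 * eps ^+ 2))).
    apply: ler_sum => j _.
    have hj : (eps * (k j)%:~R - h j) ^+ 2 <= eps ^+ 2.
      by rewrite -real_normK ?num_real// lerXn2r ?nnegrE ?(ltW eps0).
    by have := sqr_ge0 (h j - (eps * (k j)%:~R - h j)); lra.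
  rewrite big_split/= -mulr_sumr h1 sumr_const card_ord eps2 -mulr_natr.
  by rewrite le_eqVlt; apply/orP; left; apply/eqP; field; rewrite gt_eqF.
have kL' : \sum_j (k j)%:~R ^+ 2 <= (10 * m)%:R :> R.
  move: kL; under eq_bigr do rewrite exprMn.
  by rewrite -mulr_sumr eps2 ler_pdivrMl ?mulr_gt0// natrM; lra.
have kK j : (`|k j| <= 10 * m)%N.
  rewrite -(ler_nat R) (le_trans _ kL')// (bigD1 j)//=.
  rewrite (@le_trans _ _ ((k j)%:~R ^+ 2))//; last first.
    by rewrite lerDl sumr_ge0// => i _; exact: sqr_ge0.
  rewrite -[_ ^+ 2]real_normK ?num_real// -intr_norm -abszE -pmulrn -natrX ler_nat.
  by case: (absz _) => // n; rewrite -mulnn leq_pmull.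
have [k' k'E] := net_point_onto R kK.
have k'net : k' \in net by rewrite inE; under eq_bigr do rewrite k'E.
have nheavy : ~ heavy w by move=> h2; apply: wBad; left.
have nbad : ~ bad k' w.
  by move=> h2; apply: wBad; right; rewrite -bigcup_seq; exists k' => //=; rewrite mem_enum.
move/negP: nheavy; rewrite -ltNge => nheavy.
move/negP: nbad; rewrite -ltNge => nbad.
have ptE j : pt k' j = eps * (k j)%:~R by rewrite /pt k'E.
move: nbad; rewrite (eq_bigr (fun j => (eps * (k j)%:~R) ^+ 2)); last first.
  by move=> j _; rewrite ptE.
rewrite (eq_bigr (fun i => Num.min ((\sum_j eps * (k j)%:~R * e j (Z i w)) ^+ 2) B)); last first.
  by move=> i _; rewrite /combination; under eq_bigr do rewrite ptE.
rewrite mulrC -ltr_pdivlMr// mulrC => nbad.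
move: nheavy; rewrite -ltr_pdivrMl// => nheavy.
move: kgap; rewrite h1 => kgap.
rewrite /combination; lra.
Qed.

End uniform_lower_bound.

(** * The noise term *)

Section centered_sums.
Context d d1 (T : measurableType d) (U : measurableType d1) (R : realType)
  (P : probability T R).

Lemma same_law_expectation (Z1 Z2 : T -> U) (h : U -> R) :
  measurable_fun setT Z1 -> measurable_fun setT Z2 -> same_law P Z1 Z2 ->
  measurable_fun setT h -> rv_integrable P (fun w => h (Z2 w)) ->
  rv_integrable P (fun w => h (Z1 w)) /\
  \int[P]_w h (Z1 w) = \int[P]_w h (Z2 w).
Proof.
move=> m1 m2 law mh h2.
have meh : measurable_fun setT (EFin \o h) by exact/measurable_EFinP.
have h1 : rv_integrable P (fun w => h (Z1 w)).
  apply/integrableP; split; first by apply/measurable_EFinP; exact: (measurableT_comp mh).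
  rewrite (same_law_integral (g := fun u => `|(h u)%:E|%E) m1 m2 law)//; last first.
    exact: measurableT_comp.
  by have /integrableP[] := h2.
split => //; rewrite /Rintegral; congr fine.
pose Z1' : {mfun T >-> U} := HB.pack Z1 (isMeasurableFun.Build _ _ _ _ _ m1).
pose Z2' : {mfun T >-> U} := HB.pack Z2 (isMeasurableFun.Build _ _ _ _ _ m2).
have := @integral_distribution _ _ _ _ _ P Z1' (EFin \o h) meh h1.
have := @integral_distribution _ _ _ _ _ P Z2' (EFin \o h) meh h2.
rewrite /comp/= => <- <-.
by apply: eq_measure_integral => A mA _; exact: law.
Qed.

Variables (N : nat) (Z : 'I_N -> T -> U) (Z0 : T -> U).
Hypothesis indep : mutually_independent P Z.
Hypothesis mZ : forall i, measurable_fun setT (Z i).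
Hypothesis mZ0 : measurable_fun setT Z0.
Hypothesis law : forall i, same_law P (Z i) Z0.

(** The product formula with the other factors equal to 1. *)
Lemma expectation_pair (p q : U -> R) (i j : 'I_N) : i != j ->
  measurable_fun setT p -> measurable_fun setT q ->
  (forall u, 0 <= p u) -> (forall u, 0 <= q u) ->
  rv_integrable P (fun w => p (Z0 w)) -> rv_integrable P (fun w => q (Z0 w)) ->
  rv_integrable P (fun w => p (Z i w) * q (Z j w)) /\
  \int[P]_w (p (Z i w) * q (Z j w)) = \int[P]_w p (Z0 w) * \int[P]_w q (Z0 w).
Proof.
move=> ij mp mq p0 q0 ip iq.
pose g k := if k == i then p else if k == j then q else cst 1.
have mg k : measurable_fun setT (g k) by rewrite /g; do 2 case: ifP => // _.
have g0 k u : 0 <= g k u by rewrite /g; do 2 case: ifP => // _; exact: ler01.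
have ig0 k : rv_integrable P (fun w => g k (Z0 w)).
  by rewrite /g; do 2 case: ifP => // _; exact: rv_integrable_cst.
have ig k := (same_law_expectation (mZ k) mZ0 (law k) (mg k) (ig0 k)).1.
have Eg k := (same_law_expectation (mZ k) mZ0 (law k) (mg k) (ig0 k)).2.
have := expectation_prod_independent indep mZ mg g0 ig.
have prodg (F : 'I_N -> (U -> R) -> R) : (forall k, F k (cst 1) = 1) ->
    \prod_k F k (g k) = F i p * F j q.
  move=> F1; rewrite (bigD1 i)//= (bigD1 j)/=; last by rewrite eq_sym.
  rewrite {1 2}/g !eqxx eq_sym (negPf ij) big1 ?mulr1// => k /andP[/negPf ki /negPf kj].
  by rewrite /g ki kj.
under eq_integral do rewrite (prodg (fun k h => h (Z k _)))//.
rewrite (prodg (fun k h => \int[P]_w (h (Z k w)))); last by move=> k; exact: rv_expectation_cst.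
move=> E.
have mpq : measurable_fun setT (fun w => p (Z i w) * q (Z j w)).
  by apply: measurable_funM; [exact: (measurableT_comp mp)|exact: (measurableT_comp mq)].
have ipq : rv_integrable P (fun w => p (Z i w) * q (Z j w)).
  apply/integrableP; split; first exact/measurable_EFinP.
  under eq_integral do rewrite gee0_abs ?lee_fin ?mulr_ge0//.
  by rewrite [X in (X < _)%E]E ltry.
split => //; move: E; rewrite rv_integrableE// => -[->].
have := Eg i; have := Eg j; rewrite /g !eqxx eq_sym (negPf ij) => -> -> //.
Qed.

Lemma rv_integrable_sqr_integrable (f : T -> R) : measurable_fun setT f ->
  rv_integrable P (fun w => f w ^+ 2) -> rv_integrable P f.
Proof.
move=> mf f2; apply: (@rv_integrable_dom _ _ _ _ _ (fun w => 1 + f w ^+ 2)) => //.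
  move=> w; rewrite -[f w ^+ 2]real_normK ?num_real//.
  by have := sqr_ge0 (`|f w| - 1); have := normr_ge0 (f w); lra.
by apply: rv_integrableD => //; exact: rv_integrable_cst.
Qed.

(** The product formula holds for nonnegative functions; split phi into positive
    and negative parts, which have the same expectation. *)
Lemma expectation_pair_centered (phi : U -> R) (i j : 'I_N) : i != j ->
  measurable_fun setT phi -> rv_integrable P (fun w => phi (Z0 w)) ->
  \int[P]_w phi (Z0 w) = 0 ->
  rv_integrable P (fun w => phi (Z i w) * phi (Z j w)) /\
  \int[P]_w (phi (Z i w) * phi (Z j w)) = 0.
Proof.
move=> ij mphi iphi phi0.
pose p u := Num.max (phi u) 0; pose q u := Num.max (- phi u) 0.
have pq u : phi u = p u - q u.
  by rewrite /p /q; have [] := leP (phi u) 0; have [] := leP (- phi u) 0; lra.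
have mp : measurable_fun setT p by exact: measurable_maxr.
have mq : measurable_fun setT q by apply: measurable_maxr => //; exact: measurableT_comp.
have p0 u : 0 <= p u by rewrite le_max lexx orbT.
have q0 u : 0 <= q u by rewrite le_max lexx orbT.
have mphiZ : measurable_fun setT (fun w => `|phi (Z0 w)|).
  by apply: measurableT_comp => //; exact: (measurableT_comp mphi).
have inorm : rv_integrable P (fun w => `|phi (Z0 w)|) by exact: integrable_norm.
have ip : rv_integrable P (fun w => p (Z0 w)).
  apply: rv_integrable_dom inorm; first exact: (measurableT_comp mp).
  by move=> w; rewrite ger0_norm// /p ge_max ler_norm normr_ge0.
have iq : rv_integrable P (fun w => q (Z0 w)).
  apply: rv_integrable_dom inorm; first exact: (measurableT_comp mq).
  by move=> w; rewrite ger0_norm// /q ge_max -normrN ler_norm normr_ge0.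
have Epq : \int[P]_w p (Z0 w) = \int[P]_w q (Z0 w).
  apply/eqP; rewrite -subr_eq0 -rv_expectationB// -phi0; apply/eqP.
  by apply: eq_Rintegral => w _; rewrite pq.
have [ipp Epp] := expectation_pair ij mp mp p0 p0 ip ip.
have [ipq' Epq'] := expectation_pair ij mp mq p0 q0 ip iq.
have [iqp Eqp] := expectation_pair ij mq mp q0 p0 iq ip.
have [iqq Eqq] := expectation_pair ij mq mq q0 q0 iq iq.
have E : (fun w => phi (Z i w) * phi (Z j w)) = (fun w =>
    (p (Z i w) * p (Z j w) - p (Z i w) * q (Z j w)) +
    (q (Z i w) * q (Z j w) - q (Z i w) * p (Z j w))).
  by apply/funext => w; rewrite !pq; ring.
rewrite E; split; first by apply: rv_integrableD; exact: rv_integrableB.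
rewrite rv_expectationD ?rv_expectationB//; last 2 first.
- exact: rv_integrableB.
- exact: rv_integrableB.
by rewrite Epp Epq' Eqq Eqp Epq; ring.
Qed.

(** Variances of independent variables add up. *)
Lemma expectation_sqr_centered_sum (phi : U -> R) :
  measurable_fun setT phi -> rv_integrable P (fun w => phi (Z0 w) ^+ 2) ->
  \int[P]_w phi (Z0 w) = 0 ->
  rv_integrable P (fun w => (\sum_i phi (Z i w)) ^+ 2) /\
  \int[P]_w ((\sum_i phi (Z i w)) ^+ 2) = N%:R * \int[P]_w (phi (Z0 w) ^+ 2).
Proof.
move=> mphi iphi2 phi0.
have iphi : rv_integrable P (fun w => phi (Z0 w)).
  by apply: rv_integrable_sqr_integrable => //; exact: (measurableT_comp mphi).
have mphi2 : measurable_fun setT (fun u => phi u ^+ 2) by exact: measurable_funX.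
have K i j : rv_integrable P (fun w => phi (Z i w) * phi (Z j w)) /\
    \int[P]_w (phi (Z i w) * phi (Z j w)) =
    (\int[P]_w (phi (Z0 w) ^+ 2)) *+ (i == j).
  case: eqVneq => [<-|ij]; last exact: expectation_pair_centered.
  by rewrite mulr1n; apply: (same_law_expectation (h := fun u => phi u ^+ 2)).
have E : (fun w => (\sum_i phi (Z i w)) ^+ 2) =
    (fun w => \sum_i \sum_j phi (Z i w) * phi (Z j w)).
  apply/funext => w; rewrite expr2 big_distrl/=.
  by apply: eq_bigr => i _; rewrite big_distrr.
rewrite E; split.
  by apply: rv_integrable_sum => i; apply: rv_integrable_sum => j; exact: (K i j).1.
rewrite rv_expectation_sum; last first.
  by move=> i; apply: rv_integrable_sum => j; exact: (K i j).1.
rewrite (eq_bigr (fun=> \int[P]_w (phi (Z0 w) ^+ 2))).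
  by rewrite sumr_const card_ord mulr_natl.
move=> i _; rewrite rv_expectation_sum; last by move=> j; exact: (K i j).1.
rewrite (bigD1 i)//= (K i i).2 eqxx mulr1n big1 ?addr0// => j /negPf ji.
by rewrite (K i j).2 eq_sym ji.
Qed.

End centered_sums.

Lemma noise_event d d1 (T : measurableType d) (U : measurableType d1) (R : realType)
    (P : probability T R) (N m : nat) (Z : 'I_N -> T -> U) (Z0 : T -> U)
    (phi : 'I_m -> U -> R) (tau x : R) :
  mutually_independent P Z -> (forall i, measurable_fun setT (Z i)) ->
  measurable_fun setT Z0 -> (forall i, same_law P (Z i) Z0) ->
  (forall j, measurable_fun setT (phi j)) ->
  (forall j, rv_integrable P (fun w => phi j (Z0 w) ^+ 2)) ->
  (forall j, \int[P]_w phi j (Z0 w) = 0) ->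
  (forall j, \int[P]_w (phi j (Z0 w) ^+ 2) <= tau) -> 0 < x ->
  exists Bad, [/\ measurable Bad, (P Bad <= (x^-1)%:E)%E &
    forall w, ~ Bad w ->
      \sum_j (\sum_i phi j (Z i w)) ^+ 2 <= x * (m%:R * (N%:R * tau))].
Proof.
move=> indep mZ mZ0 law mphi iphi phi0 phit x0.
pose S w := \sum_j (\sum_i phi j (Z i w)) ^+ 2.
have K j := expectation_sqr_centered_sum indep mZ mZ0 law (mphi j) (iphi j) (phi0 j).
have mS : measurable_fun setT S.
  apply: measurable_bigsum => j; apply: measurable_funX; apply: measurable_bigsum => i.
  exact: (measurableT_comp (mphi j)).
exists [set w | x * (m%:R * (N%:R * tau)) < S w]; split.
- exact: measurable_ltr.
- apply: markov_strict => //.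
  + by move=> w; apply: sumr_ge0 => j _; exact: sqr_ge0.
  + by apply: rv_integrable_sum => j; exact: (K j).1.
  + rewrite rv_expectation_sum; last by move=> j; exact: (K j).1.
    rewrite mulr_natl -[in leRHS](card_ord m) -sumr_const; apply: ler_sum => j _.
    by rewrite (K j).2 ler_wpM2l.
by move=> w /negP; rewrite -leNgt.
Qed.

(** * Gram matrix of the dictionary and excess risk *)

Section gram_matrix.
Context d d' (T : measurableType d) (S : measurableType d') (R : realType)
  (P : probability T R) (X : T -> S) (M : nat) (f : 'I_M -> S -> R).
Hypothesis mX : measurable_fun setT X.
Hypothesis mf : forall j, measurable_fun setT (f j).
Hypothesis if2 : forall j, rv_integrable P (fun w => f j (X w) ^+ 2).

(** Coefficients are row vectors, so that changes of basis are matrix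
    products. *)
Definition lincomb (t : 'rV[R]_M) (x : S) : R := \sum_j t 0 j * f j x.

Lemma lin_spanP g : lin_span f g <-> exists t, g = lincomb t.
Proof.
split=> [[t ->]|[t ->]]; last by exists (t 0).
by exists (\row_j t j); apply/funext => x; apply: eq_bigr => j _; rewrite mxE.
Qed.

Lemma lincombB s t x : lincomb (s - t) x = lincomb s x - lincomb t x.
Proof. by rewrite -sumrB; apply: eq_bigr => j _; rewrite !mxE; ring. Qed.

Lemma lincombZ (c : R) s x : lincomb (c *: s) x = c * lincomb s x.
Proof. by rewrite mulr_sumr; apply: eq_bigr => j _; rewrite !mxE; ring. Qed.

Lemma lincomb_mul n (a : 'rV[R]_n) (A : 'M[R]_(n, M)) x :
  lincomb (a *m A) x = \sum_k a 0 k * lincomb (row k A) x.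
Proof.
rewrite /lincomb; under eq_bigr do rewrite mxE big_distrl/=.
rewrite exchange_big/=; apply: eq_bigr => k _.
by rewrite mulr_sumr; apply: eq_bigr => j _; rewrite !mxE mulrA.
Qed.

Lemma measurable_lincomb t : measurable_fun setT (lincomb t).
Proof. by apply: measurable_bigsum => j; exact: measurable_funM. Qed.

Let mfX j : measurable_fun setT (fun w => f j (X w)).
Proof. exact: (measurableT_comp (mf j)). Qed.

Definition gram : 'M[R]_M := \matrix_(i, j) \int[P]_w (f i (X w) * f j (X w)).

Lemma inner_lincomb s t :
  rv_integrable P (fun w => lincomb s (X w) * lincomb t (X w)) /\
  \int[P]_w (lincomb s (X w) * lincomb t (X w)) = (s *m gram *m t^T) 0 0.
Proof.
have E w : lincomb s (X w) * lincomb t (X w) =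
    \sum_j \sum_i (s 0 i * t 0 j) * (f i (X w) * f j (X w)).
  rewrite mulr_sumr; apply: eq_bigr => j _.
  by rewrite mulr_suml; apply: eq_bigr => i _; ring.
have iff i j : rv_integrable P (fun w => (s 0 i * t 0 j) * (f i (X w) * f j (X w))).
  by apply: rv_integrableZ; apply: rv_integrableM.
split.
  under eq_fun do rewrite E.
  by apply: rv_integrable_sum => j; apply: rv_integrable_sum => i.
under eq_Rintegral do rewrite E.
rewrite rv_expectation_sum; last by move=> j; apply: rv_integrable_sum => i.
rewrite mxE; apply: eq_bigr => j _.
rewrite rv_expectation_sum// !mxE big_distrl/=; apply: eq_bigr => i _.
by rewrite rv_expectationZ; [rewrite mxE; ring|exact: rv_integrableM].
Qed.

Lemma lincomb_sqr t : rv_integrable P (fun w => lincomb t (X w) ^+ 2) /\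
  \int[P]_w (lincomb t (X w) ^+ 2) = (t *m gram *m t^T) 0 0.
Proof. by have := inner_lincomb t t; under eq_fun do rewrite -expr2. Qed.

Lemma gram_psd : psd gram.
Proof.
split.
  apply/matrixP => i j; rewrite !mxE; apply: eq_Rintegral => w _.
  by rewrite mulrC.
move=> t; rewrite -(lincomb_sqr t).2; apply: Rintegral_ge0 => w _.
exact: sqr_ge0.
Qed.

End gram_matrix.

Section population.
Context d (T : measurableType d) (R : realType) (P : probability T R).
Variables (z h : T -> R).
Hypothesis mz : measurable_fun setT z.
Hypothesis mh : measurable_fun setT h.
Hypothesis iz : rv_integrable P (fun w => z w ^+ 2).
Hypothesis ih : rv_integrable P (fun w => h w ^+ 2).

Lemma expectation_sqr_sub (c : R) :
  rv_integrable P (fun w => (z w - c * h w) ^+ 2) /\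
  \int[P]_w ((z w - c * h w) ^+ 2) = \int[P]_w (z w ^+ 2)
    - 2 * c * \int[P]_w (z w * h w) + c ^+ 2 * \int[P]_w (h w ^+ 2).
Proof.
have izh : rv_integrable P (fun w => z w * h w) by exact: rv_integrableM.
have i1 : rv_integrable P (fun w => z w ^+ 2 - (2 * c) * (z w * h w)).
  by apply: rv_integrableB => //; exact: rv_integrableZ.
have i2 : rv_integrable P (fun w => c ^+ 2 * h w ^+ 2) by exact: rv_integrableZ.
have E : (fun w => (z w - c * h w) ^+ 2) =
    (fun w => (z w ^+ 2 - (2 * c) * (z w * h w)) + c ^+ 2 * h w ^+ 2).
  by apply/funext => w; ring.
rewrite E; split; first exact: rv_integrableD.
rewrite rv_expectationD// rv_expectationB//; last exact: rv_integrableZ.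
by rewrite !rv_expectationZ.
Qed.

(** The first-order condition: the quadratic polynomial c^2 E h^2 - 2 c E (z h) is
    nonnegative. *)
Lemma minimal_orthogonal :
  (forall c, \int[P]_w (z w ^+ 2) <= \int[P]_w ((z w - c * h w) ^+ 2)) ->
  \int[P]_w (z w * h w) = 0.
Proof.
move=> H; set q := \int[P]_w (z w * h w).
pose b := \int[P]_w (h w ^+ 2).
have b0 : 0 <= b by apply: Rintegral_ge0 => w _; exact: sqr_ge0.
have b1 : 0 < b + 1 by lra.
(* The minimizer is q / b; the shift keeps the witness meaningful for b = 0. *)
have := H (q / (b + 1)); rewrite (expectation_sqr_sub _).2 -/q -/b.
have E2 : 2 * (q / (b + 1)) * q - (q / (b + 1)) ^+ 2 * b =
    q ^+ 2 * ((b + 2) / (b + 1) ^+ 2) by field; rewrite gt_eqF.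
move=> le0; have : q ^+ 2 * ((b + 2) / (b + 1) ^+ 2) <= 0 by rewrite -E2; lra.
rewrite pmulr_lle0 ?divr_gt0 ?exprn_gt0//; last lra.
by move=> q20; apply/eqP; rewrite -sqrf_eq0 eq_le q20 sqr_ge0.
Qed.

End population.

(** * Empirical risk minimization *)

(** Here y_ij = e_j(X_i), z_i = zeta_i and a holds the coordinates of h. The risk
    comparison gives P_N h^2 <= 2 sum_j a_j s_j, and
    2 a_j s_j <= a_j^2 / 4 + 4 s_j^2 leaves half of the lower bound. *)
Lemma erm_deterministic (R : realType) (N m : nat) (y : 'I_N -> 'I_m -> R)
    (z : 'I_N -> R) (a : 'I_m -> R) (S : R) : (0 < N)%N ->
  1 / 2 * \sum_j a j ^+ 2 <= N%:R^-1 * \sum_i (\sum_j a j * y i j) ^+ 2 ->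
  N%:R^-1 * \sum_i (z i - \sum_j a j * y i j) ^+ 2 <= N%:R^-1 * \sum_i z i ^+ 2 ->
  \sum_j (\sum_i z i * y i j) ^+ 2 <= S ->
  \sum_j a j ^+ 2 <= 16 * (N%:R^-1 ^+ 2 * S).
Proof.
move=> N0 low erm noise.
have NR : 0 < N%:R^-1 :> R by rewrite invr_gt0 ltr0n.
pose s j := N%:R^-1 * \sum_i z i * y i j.
have sE : \sum_j s j ^+ 2 <= N%:R^-1 ^+ 2 * S.
  under eq_bigr do rewrite exprMn.
  by rewrite -mulr_sumr ler_wpM2l// sqr_ge0.
have cross : N%:R^-1 * \sum_i (\sum_j a j * y i j) ^+ 2 <= 2 * \sum_j a j * s j.
  have -> : \sum_j a j * s j = N%:R^-1 * \sum_i z i * \sum_j a j * y i j.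
    rewrite mulr_sumr.
    under [in RHS]eq_bigr do rewrite !mulr_sumr.
    rewrite exchange_big/=; apply: eq_bigr => j _.
    by rewrite /s !mulr_sumr; apply: eq_bigr => i _; ring.
  move: erm; rewrite (eq_bigr (fun i => z i ^+ 2 +
    (- 2 * (z i * \sum_j a j * y i j) + (\sum_j a j * y i j) ^+ 2))); last first.
    by move=> i _; ring.
  rewrite !big_split/= -mulr_sumr !mulrDr.
  set p := N%:R^-1 * \sum_i z i ^+ 2; set q := \sum_i _ * _; set r := _ * \sum_i _ ^+ 2.
  lra.
(* The weights leave 1/2 - 1/4 in front of the squared norm. *)
have amgm : 2 * \sum_j a j * s j <= 1 / 4 * \sum_j a j ^+ 2 + 4 * \sum_j s j ^+ 2.
  rewrite !mulr_sumr -big_split/=; apply: ler_sum => j _.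
  by have := sqr_ge0 (a j / 2 - 2 * s j); lra.
lra.
Qed.

(** In terms of p = theta^4 and n = N / (2^12 p^2) the sample size condition says
    n >= 16 m, and N / (16 B) = 2 p n >= 2 n; so half of the exponent pays for
    the net and half remains. *)
Lemma sample_size_absorbs (R : realType) (theta m M N B : R) :
  1 <= theta -> 0 <= m -> m <= M -> (2 ^+ 8 * theta ^+ 4) ^+ 2 * M <= N ->
  B = 128 * theta ^+ 4 ->
  13 * m - N / (16 * B) <= - (N / (2 ^+ 12 * theta ^+ 8)).
Proof.
move=> t1 m0 mM MN ->.
have -> : theta ^+ 8 = (theta ^+ 4) ^+ 2 by rewrite -exprM.
have p1 : 1 <= theta ^+ 4 by rewrite exprn_ege1.
move: (theta ^+ 4) p1 MN => p p1 MN.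
pose n := N / (2 ^+ 12 * p ^+ 2).
have p2 : 0 < 2 ^+ 12 * p ^+ 2 by rewrite mulr_gt0 ?exprn_gt0 ?(lt_le_trans ltr01 p1).
have -> : N / (16 * (128 * p)) = 2 * p * n.
  by rewrite /n; field; rewrite gt_eqF//; lra.
rewrite -/n.
have n16 : 16 * m <= n.
  rewrite /n ler_pdivlMr//; apply: le_trans MN.
  have -> : 16 * m * (2 ^+ 12 * p ^+ 2) = (2 ^+ 8 * p) ^+ 2 * m by ring.
  by rewrite ler_wpM2l// sqr_ge0.
have : 0 <= (p - 1) * n by rewrite mulr_ge0//; lra.
lra.
Qed.

Theorem theorem1p3 (R : realType) :
  exists c0 c1 c2 : R, [/\ 0 < c0, 0 < c1 & 0 < c2] /\
  forall (d d' : measure_display)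
    (Omega : measurableType d) (P : probability Omega R)
    (T : measurableType d')
    (X : {mfun Omega >-> T}) (Y : {RV P >-> R})
    (N M : nat)
    (Xs : 'I_N -> {mfun Omega >-> T}) (Ys : 'I_N -> {RV P >-> R})
    (f : 'I_M -> T -> R)
    (fstar : T -> R) (fhat : N.-tuple (T * R) -> T -> R)
    (theta0 : R),
  let XY := fun w : Omega => (X w, Y w) in
  let XYs := fun (i : 'I_N) (w : Omega) => (Xs i w, Ys i w) in
  let sample := fun w : Omega => [tuple XYs i w | i < N] in
  let zeta := fun w : Omega => Y w - fstar (X w) in
  let sigma := fine 'E_P[(fun w => zeta w ^+ 4)%R]%E `^ 4^-1 in
  (forall j, measurable_fun setT (f j)) ->
  ('E_P[(fun w => Y w ^+ 2)%R] < +oo)%E ->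
  (forall j, 'E_P[(fun w => f j (X w) ^+ 2)%R] < +oo)%E ->
  mutually_independent P XYs ->
  (forall i, same_law P (XYs i) XY) ->
  independent2 P XY sample ->
  0 < theta0 ->
  (forall g, lin_span f g ->
     (Lp_norm P X 4 g <= theta0%:E * Lp_norm P X 2 g)%E) ->
  (c0 * theta0 ^+ 4) ^+ 2 * M%:R <= N%:R ->
  lin_span f fstar ->
  risk P X Y fstar = min_risk P X Y (lin_span f) ->
  ('E_P[(fun w => zeta w ^+ 4)%R] < +oo)%E ->
  measurable_fun setT (fun p : N.-tuple (T * R) * T => fhat p.1 p.2) ->
  (forall z, empirical_minimizers (lin_span f) z (fhat z)) ->
  forall dist_fhat risk_fhat : Omega -> \bar R,
  cond_expectation P sample
    (fun w => (fhat (sample w) (X w) - fstar (X w)) ^+ 2) dist_fhat ->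
  cond_expectation P sample
    (fun w => (Y w - fhat (sample w) (X w)) ^+ 2) risk_fhat ->
  forall x : R, 0 < x ->
  ((1 - expR (- (N%:R / (c1 * theta0 ^+ 8))) - x^-1)%:E <=
   P [set w |
       dist_fhat w = risk_fhat w - min_risk P X Y (lin_span f) /\
       risk_fhat w - min_risk P X Y (lin_span f) <=
       (c2 * theta0 ^+ 12 * (sigma ^+ 2 * M%:R * x / N%:R))%:E])%E.
Proof.
exists (2 ^+ 8), (2 ^+ 12), 16; split; first by rewrite !exprn_gt0.
move=> d d' Om P S X Y N M Xs Ys f fstar fhat theta XY XYs sample zeta sigma.
move=> mf Y2 f2 indep law ind theta0 L42 NM sfstar minfstar z4 mfhat ERM.
move=> dist rsk condD condR x x0.
have mX : measurable_fun setT X by [].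
have mY : measurable_fun setT Y by [].
have mXY : measurable_fun setT XY by exact: measurable_fun_pair.
have mXYs i : measurable_fun setT (XYs i) by exact: measurable_fun_pair.
have tnthS i w : tnth (sample w) i = XYs i w by rewrite tnth_mktuple.
have msample : measurable_fun setT sample.
  apply/measurable_fun_tnthP => i.
  by rewrite (_ : _ \o _ = XYs i)//; apply/funext => w /=; rewrite tnthS.
have mfX j : measurable_fun setT (fun w => f j (X w)) by exact: (measurableT_comp (mf j)).
have if2 j : rv_integrable P (fun w => f j (X w) ^+ 2).
  apply: ge0_integrable; first exact: measurable_funX.
  - by move=> w; exact: sqr_ge0.
  - by have := f2 j; rewrite unlock.
have mlin t : measurable_fun setT (fun w => lincomb f t (X w)).
  exact: (measurableT_comp (measurable_lincomb mf t)).
have [ts fsE] := (lin_spanP f fstar).1 sfstar.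
have mzeta : measurable_fun setT zeta.
  by apply: measurable_funB => //; rewrite fsE.
have iz4 : rv_integrable P (fun w => zeta w ^+ 4).
  apply: ge0_integrable; first exact: measurable_funX.
  - by move=> w; rewrite -[4%N]/(2 * 2)%N exprM sqr_ge0.
  - by have := z4; rewrite unlock.
have iz2 : rv_integrable P (fun w => zeta w ^+ 2).
  apply: rv_integrable_sqr_integrable; first exact: measurable_funX.
  by under eq_fun do rewrite -exprM.
(* The minimal risk. *)
pose Rz := \int[P]_w (zeta w ^+ 2).
have riskE s : risk P X Y (lincomb f s) =
    (\int[P]_w ((zeta w - 1 * lincomb f (s - ts) (X w)) ^+ 2))%:E.
  rewrite -rv_integrableE; last first.
    exact: (expectation_sqr_sub mzeta (mlin _) iz2 (lincomb_sqr mX mf if2 _).1 1).1.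
  rewrite /risk unlock; apply: eq_integral => w _; congr (_ ^+ 2)%:E.
  by rewrite lincombB /zeta fsE; ring.
have minE : min_risk P X Y (lin_span f) = Rz%:E.
  rewrite -minfstar fsE riskE subrr; congr EFin; apply: eq_Rintegral => w _.
  congr (_ ^+ 2); rewrite /lincomb big1 ?mulr0 ?subr0// => j _.
  by rewrite mxE mul0r.
(* Compare fstar with fstar + c g for g in the span. *)
have orth t : \int[P]_w (zeta w * lincomb f t (X w)) = 0.
  apply: minimal_orthogonal => //; first exact: (lincomb_sqr mX mf if2 _).1.
  move=> c; have : (min_risk P X Y (lin_span f) <= risk P X Y (lincomb f (ts + c *: t)))%E.
    apply: ereal_inf_lbound; exists (lincomb f (ts + c *: t)) => //.
    by apply/lin_spanP; exists (ts + c *: t).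
  rewrite minE riskE addrAC subrr add0r lee_fin => /le_trans; apply.
  rewrite le_eqVlt; apply/orP; left; apply/eqP; apply: eq_Rintegral => w _.
  by rewrite lincombZ mul1r.
pose G := gram P X f.
have [m [A [mM AGA GAAG]]] := psd_factor (gram_psd mX mf if2) (rank_leq_row G).
have [sz szE] : {s : N.-tuple (S * R) -> 'rV[R]_M & forall z, fhat z = lincomb f (s z)}.
  apply: (@choice _ _ (fun z s => fhat z = lincomb f s)) => z.
  by apply/lin_spanP; have [] := ERM z.
pose hz z := sz z - ts.
pose az z := hz z *m G *m A^T.
pose qz z := \sum_j az z 0 j ^+ 2.
(* The squared L2 norm is the sum of the squared coordinates in the
   orthonormal family. *)
have hqE t : \int[P]_w (lincomb f t (X w) ^+ 2) = \sum_j (t *m G *m A^T) 0 j ^+ 2.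
  rewrite (lincomb_sqr mX mf if2 _).2 -[in LHS]GAAG -/G.
  have -> : t *m (G *m A^T *m A *m G) *m t^T = (t *m G *m A^T) *m (t *m G *m A^T)^T.
    have GT : G^T = G := (gram_psd mX mf if2).1.
    by rewrite !trmx_mul trmxK GT !mulmxA.
  by rewrite mxE; apply: eq_bigr => j _; rewrite [X in _ * X]mxE expr2.
(* Almost surely the two conditional expectations are functions of the sample. *)
have [N1 [mN1 PN1 N1E]] : P.-negligible [set w | dist w != (qz (sample w))%:E].
  pose Gd (p : N.-tuple (S * R) * (S * R)) := (fhat p.1 p.2.1 - fstar p.2.1) ^+ 2.
  have mGd : measurable_fun setT Gd.
    apply: measurable_funX; apply: measurable_funB.
      apply: (measurableT_comp mfhat (g := fun p : N.-tuple (S * R) * (S * R) => (p.1, p.2.1))).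
      by apply: measurable_fun_pair => //; exact: measurableT_comp.
    rewrite fsE; apply: (measurableT_comp (measurable_lincomb mf ts)).
    exact: measurableT_comp.
  have cd := cond_expectation_independent msample mXY ind mGd (fun=> sqr_ge0 _).
  apply: negligibleS (cond_expectation_unique msample condD cd) => w /=.
  rewrite (_ : (\int[P]_w' _)%E = (qz (sample w))%:E)//.
  rewrite /qz -hqE -rv_integrableE; last exact: (lincomb_sqr mX mf if2 _).1.
  apply: eq_integral => w' _; rewrite /Gd/= szE fsE -lincombB//.
have [N2 [mN2 PN2 N2E]] : P.-negligible [set w | rsk w != (Rz + qz (sample w))%:E].
  pose Gd (p : N.-tuple (S * R) * (S * R)) := (p.2.2 - fhat p.1 p.2.1) ^+ 2.
  have mGd : measurable_fun setT Gd.
    apply: measurable_funX; apply: measurable_funB.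
      exact: measurableT_comp.
    apply: (measurableT_comp mfhat (g := fun p : N.-tuple (S * R) * (S * R) => (p.1, p.2.1))).
    by apply: measurable_fun_pair => //; exact: measurableT_comp.
  have cd := cond_expectation_independent msample mXY ind mGd (fun=> sqr_ge0 _).
  apply: negligibleS (cond_expectation_unique msample condR cd) => w /=.
  rewrite (_ : (\int[P]_w' _)%E = (Rz + qz (sample w))%:E)//.
  have := riskE (sz (sample w)).
  rewrite (expectation_sqr_sub mzeta (mlin _) iz2 (lincomb_sqr mX mf if2 _).1 1).2.
  rewrite orth mulr0 subr0 expr1n mul1r hqE => <-.
  by rewrite /risk unlock; apply: eq_integral => w' _; rewrite /Gd/= szE.
have mdist := cond_expectation_measurable msample condD.
have mrsk := cond_expectation_measurable msample condR.
set bnd := 16 * theta ^+ 12 * _.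
have mE : measurable [set w | dist w = (rsk w - min_risk P X Y (lin_span f))%E /\
    (rsk w - min_risk P X Y (lin_span f) <= bnd%:E)%E].
  have mr : measurable_fun setT (fun w => rsk w - min_risk P X Y (lin_span f))%E.
    by rewrite minE; apply: emeasurable_funB => //; exact: measurable_cst.
  rewrite -[X in measurable X]setTI setIIr.
  apply: measurableI; first exact: measurable_eqe.
  by apply: measurable_lee => //; exact: measurable_cst.
(* Off the two null sets the event is a bound on the squared norm qz. *)
have goodE w : ~ (N1 `|` N2) w -> qz (sample w) <= bnd ->
    dist w = (rsk w - min_risk P X Y (lin_span f))%E /\
    (rsk w - min_risk P X Y (lin_span f) <= bnd%:E)%E.
  move=> /not_orP[w1 w2] qb.
  have -> : dist w = (qz (sample w))%:E by apply/eqP/negPn/negP => h; apply: w1; exact: N1E.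
  have -> : rsk w = (Rz + qz (sample w))%:E by apply/eqP/negPn/negP => h; apply: w2; exact: N2E.
  rewrite minE -EFinB (_ : Rz + qz (sample w) - Rz = qz (sample w)); last by ring.
  by rewrite lee_fin.
have negl12 : P.-negligible (N1 `|` N2).
  by apply: negligibleU; apply/negligibleP.
have M0 : 0 <= M%:R :> R by [].
have sigma20 : 0 <= sigma ^+ 2 * M%:R * x / N%:R.
  by rewrite divr_ge0// mulr_ge0 ?(ltW x0)// mulr_ge0// sqr_ge0.
(* For m = 0 every element of the span is almost surely zero. *)
have [m0|m0] := posnP m.
  apply: (probability_ge_good mE measurable0 measurable0 negl12).
  - by rewrite measure0 lee_fin expR_ge0.
  - by rewrite measure0 lee_fin invr_ge0 ltW.
  move=> w _ _ w12; apply: goodE => //.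
  rewrite /qz big1; last by move=> -[j jm]; exfalso; have := jm; rewrite m0.
  by rewrite mulr_ge0// mulr_ge0// exprn_ge0// ltW.
pose e (j : 'I_m) (u : S * R) := lincomb f (row j A) u.1.
have me j : measurable_fun setT (e j).
  exact: (measurableT_comp (measurable_lincomb mf (row j A)) measurable_fst).
have ie i j : rv_integrable P (fun w => e i (XY w) * e j (XY w)).
  exact: (inner_lincomb mX mf if2 _ _).1.
have ee i j : \int[P]_w (e i (XY w) * e j (XY w)) = (i == j)%:R.
  rewrite (inner_lincomb mX mf if2 _ _).2 -/G -row_mul tr_row.
  have := congr1 (fun B : 'M[R]_m => B i j) AGA; rewrite -/G [RHS]mxE => <-.
  by rewrite !mxE; apply: eq_bigr => k _; rewrite [row _ _ _ _]mxE [col _ _ _ _]mxE.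
have combE (a : 'I_m -> R) u : combination e a u = lincomb f ((\row_j a j) *m A) u.1.
  by rewrite lincomb_mul; apply: eq_bigr => j _; rewrite mxE.
have four t : rv_integrable P (fun w => lincomb f t (X w) ^+ 4) /\
    \int[P]_w (lincomb f t (X w) ^+ 4) <=
    theta ^+ 4 * (\int[P]_w (lincomb f t (X w) ^+ 2)) ^+ 2.
  apply: fourth_moment_of_Lnorm => //; first exact: (lincomb_sqr mX mf if2 _).1.
  by apply: L42; apply/lin_spanP; exists t.
have ie4 a : rv_integrable P (fun w => combination e a (XY w) ^+ 4).
  by under eq_fun do rewrite combE; exact: (four _).1.
have ee4 a : \int[P]_w (combination e a (XY w) ^+ 4) <=
    theta ^+ 4 * (\sum_j a j ^+ 2) ^+ 2.
  rewrite -(expectation_combination_sqr ie ee).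
  under eq_Rintegral do rewrite combE.
  under [X in _ <= _ * X ^+ 2]eq_Rintegral do rewrite combE.
  exact: (four _).2.
have e4 j : rv_integrable P (fun w => e j (XY w) ^+ 4) /\
    \int[P]_w (e j (XY w) ^+ 4) <= theta ^+ 4.
  split; first exact: (four _).1.
  apply: (le_trans (four _).2); under eq_Rintegral do rewrite expr2.
  by rewrite [X in _ * X ^+ 2](ee j j) eqxx expr1n mulr1.
(* Some element of the span has norm one, and its L4 norm is at least its L2
   norm. *)
have theta1 : 1 <= theta.
  suff : 1 <= theta ^+ 4 by rewrite expr_ge1// ltW.
  apply: le_trans (e4 (Ordinal m0)).2; apply: sqr_expectation_le.
  - by under eq_fun do rewrite expr2; exact: ie.
  - exact: (e4 _).1.
  - by under eq_Rintegral do rewrite expr2; rewrite ee eqxx.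
have N0 : (0 < N)%N.
  rewrite -(ltr0n R) (lt_le_trans _ NM)// mulr_gt0//.
    by rewrite exprn_gt0// mulr_gt0 ?exprn_gt0.
  by rewrite ltr0n (leq_trans m0).
have sigma4 : sigma ^+ 4 = \int[P]_w (zeta w ^+ 4).
  rewrite /sigma unlock powR_root//; apply: fine_ge0; apply: integral_ge0 => w _.
  by rewrite lee_fin -[4%N]/(2 * 2)%N exprM sqr_ge0.
have sigma0 : 0 <= sigma by exact: powR_ge0.
pose phi (j : 'I_m) (u : S * R) := (u.2 - fstar u.1) * e j u.
have mphi j : measurable_fun setT (phi j).
  apply: measurable_funM => //; apply: measurable_funB => //.
  rewrite fsE; exact: (measurableT_comp (measurable_lincomb mf ts) measurable_fst).
have phi2 j : rv_integrable P (fun w => phi j (XY w) ^+ 2) /\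
    \int[P]_w (phi j (XY w) ^+ 2) <= sigma ^+ 2 * theta ^+ 2.
  apply: (cauchy_schwarz_fourth mzeta (mlin (row j A)) sigma0 theta0 iz4 (e4 j).1 _ (e4 j).2).
  by rewrite sigma4.
have phi0 j : \int[P]_w phi j (XY w) = 0 by exact: orth.
pose B := 128 * theta ^+ 4.
have [Bad1 [mB1 PB1 low]] := uniform_lower_bound indep mXYs mXY law N0 m0 theta0
  me ie ee ie4 ee4 (erefl B).
have [Bad2 [mB2 PB2 noise]] := noise_event indep mXYs mXY law mphi
  (fun j => (phi2 j).1) phi0 (fun j => (phi2 j).2) x0.
(* The rows of C are the parts of the dictionary orthogonal to the family e:
   they have norm zero, hence vanish almost surely at every sample point, and
   there the coordinates determine the values of each h in the span. *)
pose C : 'M[R]_M := 1%:M - G *m A^T *m A.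
have CG : C *m G = 0 by rewrite mulmxBl mul1mx [X in _ - X]GAAG subrr.
pose q (u : S * R) := \sum_k lincomb f (row k C) u.1 ^+ 2.
have mq : measurable_fun setT q.
  apply: measurable_bigsum => k; apply: measurable_funX.
  exact: (measurableT_comp (measurable_lincomb mf (row k C)) measurable_fst).
have q0 u : 0 <= q u by apply: sumr_ge0 => k _; exact: sqr_ge0.
have iq : rv_integrable P (fun w => q (XY w)).
  by apply: rv_integrable_sum => k; exact: (lincomb_sqr mX mf if2 _).1.
have Eq : \int[P]_w q (XY w) = 0.
  rewrite rv_expectation_sum; last by move=> k; exact: (lincomb_sqr mX mf if2 _).1.
  rewrite big1// => k _; rewrite (lincomb_sqr mX mf if2 _).2 -/G.
  by rewrite -row_mul CG row0 mul0mx mxE.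
have K i := same_law_expectation (mXYs i) mXY (law i) mq iq.
pose D w := \sum_i q (XYs i w).
have D0 w : 0 <= D w by exact: sumr_ge0.
have PD : P [set w | 0 < D w] = 0%E.
  apply: null_of_expectation0 => //.
  - by apply: measurable_bigsum => i; exact: (measurableT_comp mq (mXYs i)).
  - by apply: rv_integrable_sum => i; exact: (K i).1.
  rewrite rv_expectation_sum; last by move=> i; exact: (K i).1.
  by rewrite big1// => i _; rewrite (K i).2.
have mD : measurable [set w | 0 < D w].
  apply: measurable_ltr; apply: measurable_bigsum => i.
  exact: (measurableT_comp mq (mXYs i)).
have negl : P.-negligible ((N1 `|` N2) `|` [set w | 0 < D w]).
  by apply: negligibleU => //; apply/negligibleP.
apply: (probability_ge_good mE mB1 mB2 negl _ PB2).
  apply: (le_trans PB1); rewrite lee_fin ler_expR.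
  by apply: (sample_size_absorbs theta1 _ _ NM); rewrite ?ler_nat.
move=> w w1 w2 /not_orP[w12 wD]; apply: goodE => //.
have Dz : D w = 0 by apply/eqP; rewrite eq_le D0 andbT leNgt; apply/negP.
have coord t i : lincomb f t (Xs i w) = \sum_j (t *m G *m A^T) 0 j * e j (XYs i w).
  have qz0 : q (XYs i w) = 0 by apply: (psumr_eq0P _ Dz).
  have nk k : lincomb f (row k C) (Xs i w) = 0.
    apply/eqP; rewrite -sqrf_eq0; apply/eqP.
    by apply: (psumr_eq0P _ qz0) => // l _; exact: sqr_ge0.
  rewrite -(lincomb_mul _ (t *m G *m A^T) A); apply/eqP; rewrite -subr_eq0 -lincombB.
  rewrite (_ : t - _ = t *m C); last by rewrite mulmxBr mulmx1 !mulmxA.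
  by rewrite lincomb_mul big1// => k _; rewrite nk mulr0.
have erm : N%:R^-1 * \sum_i ((Ys i w - fstar (Xs i w)) -
      \sum_j az (sample w) 0 j * e j (XYs i w)) ^+ 2 <=
    N%:R^-1 * \sum_i (Ys i w - fstar (Xs i w)) ^+ 2.
  have [_ /(_ fstar sfstar)] := ERM (sample w); rewrite /empirical_risk.
  under [in X in X <= _ -> _]eq_bigr do rewrite tnthS.
  under [in X in _ <= X -> _]eq_bigr do rewrite tnthS.
  congr (_ * _ <= _); apply: eq_bigr => i _; congr (_ ^+ 2).
  by rewrite /az -coord szE /hz lincombB fsE /=; ring.
have := erm_deterministic N0 (low w w1 (az (sample w) 0)) erm (noise w w2).
rewrite -/(qz (sample w)) => /le_trans; apply.
have -> : N%:R^-1 ^+ 2 * (x * (m%:R * (N%:R * (sigma ^+ 2 * theta ^+ 2)))) =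
    theta ^+ 2 * (sigma ^+ 2 * m%:R * x / N%:R).
  by field; rewrite pnatr_eq0 -lt0n.
(* m <= M, and theta^2 <= theta^12 as theta >= 1. *)
rewrite /bnd -[leRHS]mulrA; apply: ler_wpM2l => //; apply: ler_pM.
- by rewrite exprn_ge0// ltW.
- by rewrite divr_ge0// mulr_ge0 ?(ltW x0)// mulr_ge0// sqr_ge0.
- by rewrite ler_weXn2l.
rewrite ler_wpM2r ?invr_ge0// ler_wpM2r ?(ltW x0)// ler_wpM2l ?sqr_ge0//.
by rewrite ler_nat.
Qed.
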